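(* Consider one rigid body with Lagrangian $L=T-U$, where $T=\tfrac12 m|r_1|^2+2\langle H\theta_1,\mathbb{I}H\theta_1\rangle$ is the kinetic energy and $U$ the potential, subject to the external force $F_e=(F,2\tau)$, with holonomic constraints $g=0$ and constrained state space $M=M_\theta\cap M_{\mathsf{hc}}\subset J_1(\mathcal{E})$. For every $p=(t,y,y_1)\in M$, the linear system $$\begin{cases} E\,d+\mathsf{H}\,dg^T\lambda=F_e-8\tilde K-\mathsf{H}\nabla U\\ dg\,\mathsf{H}^Td=dg\,\mathsf{I}\,y-d^2g(y_1,y_1)\end{cases}$$ has a unique solution $(d,\lambda)\in\mathbb{R}^6\times\mathbb{R}^\ell$. Setting $y_2=\mathsf{H}^Td-\mathsf{I}y$ and $\mathcal{D}_p=\mathrm{span}\{(1,y_1,y_2)\}$ defines a one-dimensional distribution on $M$ (that is, $\mathcal{D}_p\subset T_pM\cap\mathcal{C}_p$ for all $p\in M$), and it is the distribution of the dynamics: a smooth curve $t\mapsto y(t)$ is a motion of the constrained rigid body if and only if $t\mapsto(t,y(t),y'(t))$ is a curve in $M$ which is an integral curve of $\mathcal{D}$.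
   Context: All data are smooth. The bundle is $\mathcal{E}=\mathbb{R}\times\mathbb{R}^7\to\mathbb{R}$ with fibre coordinates $y=(r,\theta)$, $r\in\mathbb{R}^3$ (centre of mass), $\theta=(\theta^0,\theta^1,\theta^2,\theta^3)\in\mathbb{R}^4$ (Euler parameters, to be constrained to the unit sphere $S^3$). $J_1(\mathcal{E})\simeq\mathbb{R}^{15}$ has coordinates $(t,y,y_1)$, $y_1=(r_1,\theta_1)$; along a curve, subscripts $1,2$ mean first and second derivatives in $t$. The Cartan distribution is $\mathcal{C}_p=\{v\in T_pJ_1(\mathcal{E}) : (dy^i-y^i_1dt)(v)=0,\ i=1,\dots,7\}$. For $\theta\in\mathbb{R}^4$, $$H=H(\theta)=\begin{pmatrix}-\theta^1&\theta^0&\theta^3&-\theta^2\\-\theta^2&-\theta^3&\theta^0&\theta^1\\-\theta^3&\theta^2&-\theta^1&\theta^0\end{pmatrix},\qquad H_1=H(\theta_1).$$ $m>0$ is the mass and $\mathbb{I}\in\mathbb{R}^{3\times3}$ the inertia tensor (symmetric positive definite). $U$ is a real function of $y$, with gradient $\nabla U\in\mathbb{R}^7$. $F\in\mathbb{R}^3$ is the resultant external force (at the centre of mass) and $\tau\in\mathbb{R}^3$ the torque in body coordinates; both are given functions of $(t,y,y_1)$. The constraint map $g:\mathcal{E}\to\mathbb{R}^\ell$ does not depend on $t$; $dg$ is its $\ell\times7$ Jacobian in $y$ and $d^2g(y_1,y_1)\in\mathbb{R}^\ell$ its second differential, taken componentwise. Notation: $$\mathsf{H}=\begin{pmatrix}I_3&0\\0&H\end{pmatrix}\in\mathbb{R}^{6\times7},\quad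 \mathsf{I}=\begin{pmatrix}0&0\\0&|\theta_1|^2I_4\end{pmatrix}\in\mathbb{R}^{7\times7},\quad E=\begin{pmatrix}mI_3&0\\0&4\mathbb{I}\end{pmatrix},\quad \tilde K=\begin{pmatrix}0\\ H\,H_1^T\,\mathbb{I}\,H\theta_1\end{pmatrix}\in\mathbb{R}^6.$$ $M_\theta=\{(t,y,y_1): |\theta|^2=1,\ \langle\theta,\theta_1\rangle=0\}$, $M_{\mathsf{hc}}=\{(t,y,y_1): g(y)=0,\ dg\,y_1=0\}$, $M=M_\theta\cap M_{\mathsf{hc}}$. The constraints are assumed independent: $dg\,\mathsf{H}^T$ has rank $\ell$ at all points of $M$. Motions. A smooth curve $y=(r,\theta)$ is a motion of the constrained rigid body if $|\theta(t)|=1$, $g(y(t))=0$ for all $t$, and for every local parametrisation $\varphi:U_1\subset\mathbb{R}^3\to S^3$ (diffeomorphism onto an open subset of $S^3$), whenever $\theta=\varphi(\alpha)$ and with $q=(r,\alpha)$, $\Phi(r,\alpha)=(r,\varphi(\alpha))$, there is $\lambda(t)\in\mathbb{R}^\ell$ such that $$\frac{d}{dt}\frac{\partial L}{\partial q_1}-\frac{\partial L}{\partial q}=\begin{pmatrix}F\\2\,d\varphi^TH^T\tau\end{pmatrix}-d(g\circ\Phi)^T\lambda,$$ where $L=T-U$ is expressed in $(q,q_1)$ through $y=\Phi(q)$, $y_1=d\Phi\,q_1$. *)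

(* Defs.v *)
From HB Require Import structures.
From mathcomp Require Import all_boot all_order all_algebra.
From mathcomp Require Import all_classical all_reals all_analysis.

Set Implicit Arguments.
Unset Strict Implicit.
Unset Printing Implicit Defensive.

Import Order.TTheory GRing.Theory Num.Theory.
Import numFieldNormedType.Exports.

Local Open Scope classical_set_scope.
Local Open Scope ring_scope.

(* f is C^k on the open set A; in finite dimension, df : A -> Hom(V, W) is C^k
   if and only if x |-> df_x(v) is C^k for every fixed v. *)
Fixpoint Ck_on (R : realType) (V W : normedModType R) (k : nat)
    (A : set V) (f : V -> W) : Prop :=
  match k with
  | 0%N => forall x, A x -> {for x, continuous f}
  | k'.+1 => (forall x, A x -> differentiable f x) /\
             (forall v, Ck_on k' A (fun x => 'd f x v))
  end.

Definition smooth_on (R : realType) (V W : normedModType R)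
    (A : set V) (f : V -> W) : Prop :=
  forall k, Ck_on k A f.

(* Smoothness on an arbitrary subset X: locally f extends to a smooth map on an
   open subset of the ambient space. *)
Definition smooth_on_subset (R : realType) (V W : normedModType R)
    (X : set V) (f : V -> W) : Prop :=
  forall x, X x -> exists (A : set V) (h : V -> W),
    [/\ open A, A x, smooth_on A h & forall z, (A `&` X) z -> h z = f z].

(* Counterpart for column vectors of the library's 'J, which acts on rows. *)
Definition jac (R : realType) (n k : nat) (f : 'cV[R]_n -> 'cV[R]_k)
    (x : 'cV[R]_n) : 'M[R]_(k, n) :=
  \matrix_(i, j) ('d f x (delta_mx j 0)) i 0.

Definition grad (R : realType) (n : nat) (f : 'cV[R]_n -> R)
    (x : 'cV[R]_n) : 'cV[R]_n :=
  \col_j 'd f x (delta_mx j 0).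

(* Second differential d^2 f_x(v, v). *)
Definition diff2 (R : realType) (V W : normedModType R) (f : V -> W)
    (x v : V) : W :=
  'd (fun z => 'd f z v) x v.

(* Euclidean inner product; the norm `|v| of the library is the sup norm. *)
Definition dot (R : realType) (n : nat) (u v : 'cV[R]_n) : R :=
  (u^T *m v) 0 0.

Definition posdefmx (R : realType) (n : nat) (A : 'M[R]_n) : Prop :=
  A^T = A /\ forall v : 'cV[R]_n, v != 0 -> 0 < dot v (A *m v).

Notation jet R := (R * 'cV[R]_(3 + 4) * 'cV[R]_(3 + 4))%type (only parsing).

Section JetCoordinates.
Context {R : realType}.
Implicit Types (y : 'cV[R]_(3 + 4)) (p : jet R).

Definition pos_of y : 'cV[R]_3 := usubmx y.
Definition eul_of y : 'cV[R]_4 := dsubmx y.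

Definition jt p : R := p.1.1.
Definition jy p : 'cV[R]_(3 + 4) := p.1.2.
Definition jy1 p : 'cV[R]_(3 + 4) := p.2.

Definition prolong (y : R -> 'cV[R]_(3 + 4)) (t : R) : jet R :=
  (t, y t, (y^`()%classic) t).

End JetCoordinates.

Definition Hmx (R : realType) (theta : 'cV[R]_4) : 'M[R]_(3, 4) :=
  let th (k : nat) : R := theta (inord k) 0 in
  \matrix_(i < 3, j < 4)
    nth 0 (nth [::] [:: [:: - th 1%N; th 0%N; th 3%N; - th 2%N];
                        [:: - th 2%N; - th 3%N; th 0%N; th 1%N];
                        [:: - th 3%N; th 2%N; - th 1%N; th 0%N]] i) j.

Definition bigH (R : realType) (y : 'cV[R]_(3 + 4)) : 'M[R]_(3 + 3, 3 + 4) :=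
  block_mx 1%:M 0 0 (Hmx (eul_of y)).

Definition bigI (R : realType) (y1 : 'cV[R]_(3 + 4)) : 'M[R]_(3 + 4) :=
  block_mx 0 0 0 (dot (eul_of y1) (eul_of y1))%:M.

Record rigid_body (R : realType) (l : nat) := RigidBody {
  mass : R;
  inertia : 'M[R]_3;
  potential : 'cV[R]_(3 + 4) -> R;
  force : jet R -> 'cV[R]_3;
  torque : jet R -> 'cV[R]_3;
  constraint : 'cV[R]_(3 + 4) -> 'cV[R]_l }.

Section RigidBody.
Context {R : realType} {l : nat}.
Variable B : rigid_body R l.
Implicit Types (y : 'cV[R]_(3 + 4)) (p : jet R).

Definition well_posed_data : Prop :=
  [/\ 0 < mass B, posdefmx (inertia B) &
      [/\ smooth_on setT (potential B), smooth_on setT (force B),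
          smooth_on setT (torque B) & smooth_on setT (constraint B)]].

Definition kinetic y y1 : R :=
  let w := Hmx (eul_of y) *m eul_of y1 in
  2^-1 * mass B * dot (pos_of y1) (pos_of y1) + 2 * dot w (inertia B *m w).

Definition lagrangian y y1 : R := kinetic y y1 - potential B y.

Definition M_theta : set (jet R) :=
  [set p | dot (eul_of (jy p)) (eul_of (jy p)) = 1 /\
           dot (eul_of (jy p)) (eul_of (jy1 p)) = 0].

Definition M_hc : set (jet R) :=
  [set p | constraint B (jy p) = 0 /\ jac (constraint B) (jy p) *m jy1 p = 0].

Definition state_space : set (jet R) := M_theta `&` M_hc.

Definition independent_constraints : Prop :=
  forall p, state_space p ->
    \rank (jac (constraint B) (jy p) *m (bigH (jy p))^T) = l.

Definition inertia_mx : 'M[R]_(3 + 3) :=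
  block_mx (mass B)%:M 0 0 (4 *: inertia B).

Definition Ktilde p : 'cV[R]_(3 + 3) :=
  let H := Hmx (eul_of (jy p)) in
  let theta1 := eul_of (jy1 p) in
  col_mx 0 (H *m (Hmx theta1)^T *m inertia B *m H *m theta1).

Definition ext_force p : 'cV[R]_(3 + 3) := col_mx (force B p) (2 *: torque B p).

Definition dyn_system p (dl : 'cV[R]_(3 + 3) * 'cV[R]_l) : Prop :=
  let y := jy p in let y1 := jy1 p in
  let dg := jac (constraint B) y in
  inertia_mx *m dl.1 + bigH y *m dg^T *m dl.2
    = ext_force p - 8 *: Ktilde p - bigH y *m grad (potential B) y /\
  dg *m (bigH y)^T *m dl.1
    = dg *m bigI y1 *m y - diff2 (constraint B) y y1.

Definition acceleration p (d : 'cV[R]_(3 + 3)) : 'cV[R]_(3 + 4) :=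
  (bigH (jy p))^T *m d - bigI (jy1 p) *m jy p.

(* The line spanned by (1, y1, y2), y2 being given by the (at points of the
   state space, unique) solution of the linear system. *)
Definition dyn_distribution p : set (jet R) :=
  [set v | exists2 dl, dyn_system p dl &
     exists c : R, v = c *: ((1, jy1 p, acceleration p dl.1) : jet R)].

End RigidBody.

Section Distributions.
Context {R : realType}.

Definition cartan (p : jet R) : set (jet R) :=
  [set v | forall i, jy v i 0 - jy1 p i 0 * jt v = 0].

(* Velocities at p of the smooth curves in X through p. *)
Definition tangent_space (X : set (jet R)) (p : jet R) : set (jet R) :=
  [set v | exists (e : R) (c : R -> jet R),
     [/\ 0 < e, smooth_on `]-e, e[ c, (forall s, s \in `]-e, e[ -> X (c s)),
         c 0 = p & c^`()%classic 0 = v]].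

Definition one_dimensional (D : set (jet R)) : Prop :=
  exists2 v : jet R, v != 0 & D = [set c *: v | c in [set: R]].

Definition integral_curve (I : set R) (c : R -> jet R)
    (D : jet R -> set (jet R)) : Prop :=
  forall t, I t -> D (c t) (c^`()%classic t).

End Distributions.

Definition S3 {R : realType} : set 'cV[R]_4 := [set x | dot x x = 1].

(* phi is a diffeomorphism from the open set A onto an open subset of S^3. *)
Definition local_param (R : realType) (A : set 'cV[R]_3)
    (phi : 'cV[R]_3 -> 'cV[R]_4) : Prop :=
  [/\ open A, smooth_on A phi,
      (exists2 O : set 'cV[R]_4, open O & phi @` A = O `&` S3) &
      exists2 psi : 'cV[R]_4 -> 'cV[R]_3,
        smooth_on_subset (phi @` A) psi & forall a, A a -> psi (phi a) = a].

Section Motions.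
Context {R : realType} {l : nat}.
Variable B : rigid_body R l.

Definition chart_map (phi : 'cV[R]_3 -> 'cV[R]_4) (q : 'cV[R]_(3 + 3)) :
    'cV[R]_(3 + 4) :=
  col_mx (usubmx q) (phi (dsubmx q)).

Definition chart_lagrangian phi (q q1 : 'cV[R]_(3 + 3)) : R :=
  lagrangian B (chart_map phi q) (jac (chart_map phi) q *m q1).

Definition euler_lagrange phi (q : R -> 'cV[R]_(3 + 3)) (t : R) :
    'cV[R]_(3 + 3) :=
  let q1 := q^`()%classic in
  (fun s => grad (chart_lagrangian phi (q s)) (q1 s))^`()%classic t
  - grad (fun z => chart_lagrangian phi z (q1 t)) (q t).

(* The chart is used over any open set J of times at which theta = phi(alpha);
   alpha is then determined by theta, hence smooth. *)
Definition is_motion (I : set R) (y : R -> 'cV[R]_(3 + 4)) : Prop :=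
  (forall t, I t -> S3 (eul_of (y t)) /\ constraint B (y t) = 0) /\
  forall (A : set 'cV[R]_3) (phi : 'cV[R]_3 -> 'cV[R]_4), local_param A phi ->
  forall (J : set R) (alpha : R -> 'cV[R]_3), open J -> J `<=` I ->
    (forall t, J t -> A (alpha t) /\ eul_of (y t) = phi (alpha t)) ->
  let q t := col_mx (pos_of (y t)) (alpha t) in
  forall t, J t -> exists lambda : 'cV[R]_l,
    euler_lagrange phi q t =
      col_mx (force B (prolong y t))
        (2 *: ((jac phi (alpha t))^T *m (Hmx (eul_of (y t)))^T
               *m torque B (prolong y t)))
      - (jac (constraint B \o chart_map phi) (q t))^T *m lambda.

End Motions.

(* Main.v *)
(* In a chart [phi] of the sphere the Euler-Lagrange operator is
   [dPhi^T (d/dt dL/dy1 - dL/dy)] because second differentials are symmetric.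
   On the unit sphere [H H^T = 1] and [H^T H = 1 - theta theta^T], so the Jacobian
   of a chart factors as [H^T P] with [P] invertible; cancelling [diag(1, P^T)]
   turns the chart equation into the chart-free body equation, with [d = H y2],
   that is the first line of the linear system. Differentiating the constraints
   twice along the curve gives the second line and [y2 = H^T d - I y].
   Conversely stereographic charts cover the sphere. The system is uniquely
   solvable since its saddle-point matrix is injective. For tangency to the
   state space a smooth curve with prescribed 2-jet is constructed in a level set
   [G = 0] as [y0 + s y1 + s^2/2 y2 + W u(s)], with [W] a right inverse of
   [dG], by a fixed-point argument; the curve solves an ODE with smooth right-hand
   side, hence is smooth. *)

(* The linear system has a six-dimensional unknown [d] although [y2] has seven components. For unit
   theta, R^7 splits orthogonally into the range of the transpose of [bigH y] and the line spanned
   by (0, theta). Differentiating |theta|^2 = 1 twice forces the component of [y2] on that line: it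
   is exactly [- bigI y1 *m y]. The force balance and the constraints g only have to determine the
   rest. Tangency needs no parametrisation of the state space. A triple (t, y, y1) lies in it when y
   is a zero of G = (|theta|^2 - 1, g) and y1 is in the kernel of dG. So the prolongation of any
   curve in the zero set of G stays in the state space, and its velocity is (1, y', y''). The
   obstacle is regularity. The fixed point is found for each time separately and selected by choice,
   so nothing is continuous a priori. A Lipschitz estimate against the quadratic polynomial, valid
   for every selection, gives continuity, then a derivative, then the ODE. Likewise the chart
   coordinate [alpha] of a motion is an arbitrary function, whose two derivatives must be shown to
   exist before the Euler-Lagrange expression can be computed. *)
Require Import Defs.
From HB Require Import structures.
From mathcomp Require Import all_boot all_order all_algebra.
From mathcomp Require Import all_classical all_reals all_analysis.
From mathcomp Require Import ring lra.
Import Order.TTheory GRing.Theory Num.Theory.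
Import numFieldNormedType.Exports.

Local Open Scope classical_set_scope.
Local Open Scope ring_scope.

Set Implicit Arguments.
Unset Strict Implicit.
Unset Printing Implicit Defensive.

(** * Differentials of matrix-valued maps *)

Section Differentials.
Context {R : realType}.

Section General.
Context {V W : normedModType R}.
Implicit Types (f g : V -> W) (x : V).

(** Explicit tolerances replace Landau symbols because the derivative of the implicitly defined
    curve comes out of norm estimates. *)
Lemma is_diff_eps f x (L : {linear V -> W}) : continuous L ->
  (forall e : R, 0 < e ->
     \forall h \near (0 : V), `|f (h + x) - f x - L h| <= e * `|h|) ->
  is_diff x f L.
Proof.
move=> Lc Le.
have fx : f \o shift x = cst (f x) + L +o_ 0 id.
  apply/eqaddoP => e e0; near=> h.
  by rewrite /= !fctE opprD addrA; near: h; exact: Le.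
have dE := diff_unique Lc fx.
apply: DiffDef => //; apply/diff_locallyP; split; first by rewrite dE.
by rewrite dE.
Unshelve. all: by end_near. Qed.

Lemma diff_eps f x : differentiable f x -> forall e : R, 0 < e ->
  \forall h \near (0 : V), `|f (h + x) - f x - 'd f x h| <= e * `|h|.
Proof.
move=> /diff_locally/eqaddoP + e e0 => /(_ e e0) fe; near=> h.
have : `|((f \o shift x) - (cst (f x) + 'd f x)) h| <= e * `|id h|.
  by near: h.
by rewrite /= !fctE opprD addrA.
Unshelve. all: by end_near. Qed.

Lemma near_eq_is_diff f g df x :
  (\forall z \near x, f z = g z) -> is_diff x f df -> is_diff x g df.
Proof.
move=> fg [fd fdf]; rewrite -fdf; apply: is_diff_eps.
  exact: diff_continuous.
move=> e e0; have fe := diff_eps fd e0.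
have fgx : f x = g x := nbhs_singleton fg.
have fg0 : \forall h \near (0 : V), f (h + x) = g (h + x).
  by move: fg; rewrite (near_shift 0) /= subr0.
by near=> h; rewrite -fgx -(near fg0 h)//; near: h.
Unshelve. all: by end_near. Qed.

Lemma diffE_near f g x : (\forall z \near x, f z = g z) ->
  differentiable f x -> 'd f x = 'd g x :> (V -> W).
Proof.
by move=> fg /differentiableP fd; have := near_eq_is_diff fg fd; case=> _ ->.
Qed.

Lemma is_diff_ext f g df dg x :
  f =1 g -> df =1 dg -> is_diff x f df -> is_diff x g dg.
Proof. by move=> /funext -> /funext ->. Qed.

Lemma is_diff_val f df x v : is_diff x f df -> 'd f x v = df v.
Proof. by case=> _ ->. Qed.

Lemma is_diff_linear (L : {linear V -> W}) x : continuous L -> is_diff x L L.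
Proof.
by move=> Lc; apply: DiffDef; [exact: linear_differentiable|exact: diff_lin].
Qed.

Lemma is_diffZf (k dk : V -> R) f df x : is_diff x k dk -> is_diff x f df ->
  is_diff x (fun z => k z *: f z) (fun v => k x *: df v + dk v *: f x).
Proof.
move=> [kd <-] [fd <-].
(* Scaling is packed as a bilinear map, so that the product rule becomes the chain rule through the
   pair (k, f). *)
have bl : bilinear_for (GRing.Scale.Law.clone _ _ *:%R _)
   (GRing.Scale.Law.clone _ _ *:%R _) (fun (a : R) (w : W) => a *: w).
  split=> [u'|u] a y z /=; first by rewrite scalerDl scalerA.
  by rewrite scalerDr scalerA mulrC -scalerA.
pose BM := bilinear_isBilinear.Build _ _ _ _ _ _ _ bl.
pose B : {bilinear R -> W -> W} := HB.pack (fun (a : R) (w : W) => a *: w) BM.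
have Bc : continuous (fun p : R * W => B p.1 p.2).
  by move=> p; exact: scale_continuous.
have dp := differentiable_pair kd fd.
have dB : differentiable (fun p : R * W => B p.1 p.2) (k x, f x).
  exact: differentiable_bilin.
apply: DiffDef.
  exact: (@differentiable_comp _ _ _ _ (fun z => (k z, f z))
    (fun p : R * W => B p.1 p.2)).
rewrite [LHS](@diff_comp _ _ _ _ (fun z => (k z, f z))
  (fun p : R * W => B p.1 p.2) x)// diff_bilin// diff_pair//.
Qed.

Lemma is_diff_sum (I : Type) (r : seq I) (f df : I -> V -> W) x :
  (forall i, is_diff x (f i) (df i)) ->
  is_diff x (fun z => \sum_(i <- r) f i z) (fun v => \sum_(i <- r) df i v).
Proof.
move=> fd; elim: r => [|i r IH].
  by apply: (is_diff_ext _ _ (is_diff_cst 0 x)) => z; rewrite big_nil.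
by apply: (is_diff_ext _ _ (is_diffD (fd i) IH)) => z;
   rewrite big_cons.
Qed.

End General.

Section Matrices.
Context {V : normedModType R}.
Implicit Type x : V.

Lemma is_diff_coord m n (i : 'I_m) (j : 'I_n) (M dM : V -> 'M[R]_(m, n)) x :
  is_diff x M dM -> is_diff x (fun z => M z i j) (fun v => dM v i j).
Proof.
move=> MdM.
have @c : {linear 'M[R]_(m, n) -> R}.
  by exists (fun N : 'M[R]_(_, _) => N i j); do 2![eexists]; do ?[constructor];
     rewrite ?mxE// => ? *; rewrite ?mxE//; move=> ?; rewrite !mxE.
have cc : is_diff (M x) c c.
  by apply: is_diff_linear => z; exact: coord_continuous.
exact: (@is_diff_comp _ _ _ _ M dM c c x).
Qed.

Lemma is_diff_mx m n (M dM : V -> 'M[R]_(m, n)) x :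
  (forall i j, is_diff x (fun z => M z i j) (fun v => dM v i j)) ->
  is_diff x M dM.
Proof.
move=> Md.
have E (N : V -> 'M[R]_(m, n)) : N =1 fun z =>
    \sum_i \sum_j (N z i j *: delta_mx i j : 'M[R]_(m, n)).
  by move=> z; rewrite -matrix_sum_delta.
apply: (is_diff_ext (fsym (E M)) (fsym (E dM))).
apply: is_diff_sum => i; apply: is_diff_sum => j.
apply: (is_diff_ext _ _ (is_diffZf (Md i j)
  (is_diff_cst (delta_mx i j : 'M[R]_(m, n)) x))) => // v.
by rewrite scaler0 add0r.
Qed.

Lemma is_diff_mulmx m n p (M dM : V -> 'M[R]_(m, n)) (N dN : V -> 'M[R]_(n, p))
    x : is_diff x M dM -> is_diff x N dN ->
  is_diff x (fun z => M z *m N z) (fun v => M x *m dN v + dM v *m N x).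
Proof.
move=> Md Nd; apply: is_diff_mx => i j.
have h (l : 'I_n) := is_diffZf (is_diff_coord i l Md) (is_diff_coord l j Nd).
apply: (is_diff_ext _ _ (is_diff_sum (index_enum _) h)) => z.
  by rewrite mxE.
by rewrite !mxE -big_split.
Qed.

(** The entries of [L N] are finite combinations of the entries of [N], so continuity of [L] need
    not be assumed; it is read off from this lemma afterwards. *)
Lemma is_diff_mxlin m n p q (L : {linear 'M[R]_(m, n) -> 'M[R]_(p, q)})
    (M dM : V -> 'M[R]_(m, n)) x :
  is_diff x M dM -> is_diff x (fun z => L (M z)) (fun v => L (dM v)).
Proof.
move=> Md; apply: is_diff_mx => i j.
have E N : L N i j = \sum_k \sum_l N k l *: (L (delta_mx k l) i j).
  rewrite [in LHS](matrix_sum_delta N) linear_sum summxE; apply: eq_bigr => k _.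
  by rewrite linear_sum summxE; apply: eq_bigr => l _; rewrite linearZ mxE.
apply: (is_diff_ext (fun z => esym (E _)) (fun z => esym (E _))).
apply: is_diff_sum => k; apply: is_diff_sum => l.
apply: (is_diff_ext _ _ (is_diffZf (is_diff_coord k l Md)
  (is_diff_cst (L (delta_mx k l) i j) x))) => // v.
by rewrite scaler0 add0r.
Qed.

Lemma is_diff_col_mx m1 m2 n (M dM : V -> 'M[R]_(m1, n))
    (N dN : V -> 'M[R]_(m2, n)) x : is_diff x M dM -> is_diff x N dN ->
  is_diff x (fun z => col_mx (M z) (N z)) (fun v => col_mx (dM v) (dN v)).
Proof.
move=> Md Nd; apply: is_diff_mx => i j; case: (split_ordP i) => k ->.
  by apply: (is_diff_ext _ _ (is_diff_coord k j Md)) => z; rewrite col_mxEu.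
by apply: (is_diff_ext _ _ (is_diff_coord k j Nd)) => z; rewrite col_mxEd.
Qed.

End Matrices.

Lemma mxlin_continuous m n p q (L : {linear 'M[R]_(m, n) -> 'M[R]_(p, q)}) :
  continuous L.
Proof.
move=> x; have := @is_diff_mxlin _ _ _ _ _ L id id x (is_diff_id x).
by case=> /differentiable_continuous.
Qed.

Lemma jac_mulmx n k (f : 'cV[R]_n -> 'cV[R]_k) x v : jac f x *m v = 'd f x v.
Proof.
apply/matrixP => i j; rewrite (ord1 j) mxE [in RHS](matrix_sum_delta v).
rewrite linear_sum summxE; apply: eq_bigr => l _.
by rewrite big_ord1 linearZ !mxE mulrC.
Qed.

Lemma grad_dot n (f : 'cV[R]_n -> R) x v : dot (grad f x) v = 'd f x v.
Proof.
rewrite /dot mxE [in RHS](matrix_sum_delta v) linear_sum; apply: eq_bigr => l _.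
by rewrite big_ord1 linearZ !mxE mulrC.
Qed.

End Differentials.

(** * Smooth functions *)

Section Smoothness.
Context {R : realType}.

Section Closure.
Context {V W : normedModType R}.
Implicit Types (A : set V) (f g : V -> W) (k : nat).

(** On an open set the two maps agree near each point, hence so do their differentials, and the
    induction can pass to them. *)
Lemma Ck_on_ext k A f g : open A -> (forall x, A x -> f x = g x) ->
  Ck_on k A f -> Ck_on k A g.
Proof.
move=> Ao; elim: k f g => [|k IH] f g fg /=.
  move=> fc x Ax; have fgx : \forall z \near x, f z = g z.
    by near=> z; apply: fg; near: z; exact: open_nbhs_nbhs.
  have := fc x Ax; rewrite /prop_for /continuous_at -(fg x Ax) => fcx.
  by apply: cvg_trans fcx; apply: near_eq_cvg.
have fgx x : A x -> \forall z \near x, f z = g z.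
  by move=> Ax; near=> z; apply: fg; near: z; exact: open_nbhs_nbhs.
move=> [fd fk]; split=> [x Ax|v].
  by have [] := near_eq_is_diff (fgx x Ax) (differentiableP (fd x Ax)).
apply: IH (fk v) => x Ax.
exact: (congr1 (@^~ v) (diffE_near (fgx x Ax) (fd x Ax))).
Unshelve. all: by end_near. Qed.

Lemma Ck_onW k A f : Ck_on k.+1 A f -> Ck_on k A f.
Proof.
elim: k f => [|k IH] f [fd fk].
  by move=> x Ax; exact/differentiable_continuous/fd.
by split=> // v; apply: IH.
Qed.

Lemma Ck_on_sub k A A' f : A `<=` A' -> Ck_on k A' f -> Ck_on k A f.
Proof.
move=> AA; elim: k f => [|k IH] f /=; first by move=> fc x /AA; exact: fc.
by move=> [fd fk]; split=> [x /AA|v]; [exact: fd|exact: IH].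
Qed.

Lemma Ck_on_cst k A (c : W) : Ck_on k A (cst c).
Proof.
elim: k c => [|k IH] c /=; first by move=> x _; exact: cst_continuous.
split=> [x _|v]; first exact: differentiable_cst.
by under eq_fun do rewrite diff_cst; exact: IH.
Qed.

Lemma Ck_on_linear k A (L : {linear V -> W}) : continuous L -> Ck_on k A L.
Proof.
move=> Lc; case: k => [|k] /=; first by move=> x _; exact: Lc.
split=> [x _|v]; first exact: linear_differentiable.
by under eq_fun do rewrite diff_lin//; exact: Ck_on_cst.
Qed.

Lemma Ck_onD k A f g : open A -> Ck_on k A f -> Ck_on k A g ->
  Ck_on k A (fun x => f x + g x).
Proof.
move=> Ao; elim: k f g => [|k IH] f g /=.
  by move=> fc gc x Ax; apply: continuousD; [exact: fc|exact: gc].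
move=> [fd fk] [gd gk]; split=> [x Ax|v].
  by apply: differentiableD; [exact: fd|exact: gd].
apply: Ck_on_ext (IH _ _ (fk v) (gk v)) => // x Ax.
exact: (esym (congr1 (@^~ v) (diffD (fd x Ax) (gd x Ax)))).
Qed.

End Closure.

Section Sums.
Context {V W : normedModType R}.
Implicit Types (A : set V) (f g : V -> W) (k : nat).

Lemma Ck_onZf k A (c : V -> R) f : open A -> Ck_on k A c -> Ck_on k A f ->
  Ck_on k A (fun x => c x *: f x).
Proof.
move=> Ao; elim: k c f => [|k IH] c f.
  move=> /= cc fc x Ax.
  by apply: cvgZ; [exact: cc|exact: fc].
move=> cS fS; have [cd ck] := cS; have [fd fk] := fS.
have D x : A x ->
    is_diff x (fun z => c z *: f z) (fun v => c x *: 'd f x v + 'd c x v *: f x).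
  by move=> Ax; apply: is_diffZf; apply: differentiableP; [exact: cd|exact: fd].
split=> [x /D[]//|v].
apply: (@Ck_on_ext _ _ _ _ (fun x => c x *: 'd f x v + 'd c x v *: f x)) => //.
  by move=> x Ax; exact/esym/(is_diff_val v (D x Ax)).
apply: Ck_onD => //; first exact: IH _ _ (Ck_onW cS) (fk v).
exact: IH _ _ (ck v) (Ck_onW fS).
Qed.

Lemma Ck_on_sum k A (I : Type) (r : seq I) (f : I -> V -> W) : open A ->
  (forall i, Ck_on k A (f i)) -> Ck_on k A (fun x => \sum_(i <- r) f i x).
Proof.
move=> Ao fk; elim: r => [|i r IH].
  by under eq_fun do rewrite big_nil; exact: Ck_on_cst.
by under eq_fun do rewrite big_cons; exact: Ck_onD.
Qed.

End Sums.

Lemma Ck_on_linear_comp {V W W' : normedModType R} k (A : set V)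
    (L : {linear W -> W'}) (f : V -> W) : open A -> continuous L ->
  Ck_on k A f -> Ck_on k A (fun x => L (f x)).
Proof.
move=> Ao Lc; elim: k f => [|k IH] f /=.
  move=> fc x Ax; apply: (@continuous_comp _ _ _ f L); first exact: fc.
  exact: Lc.
move=> [fd fk]; have D x : A x -> is_diff x (fun z => L (f z)) (fun v => L ('d f x v)).
  move=> Ax; have fx := differentiableP (fd x Ax).
  exact: (is_diff_comp fx (is_diff_linear _ Lc)).
split=> [x /D[]//|v].
apply: (@Ck_on_ext _ _ _ _ (fun x => L ('d f x v)) _ Ao _ (IH _ (fk v))) => x Ax.
exact/esym/(is_diff_val v (D x Ax)).
Qed.

Lemma Ck_on_comp_linear {V V' W : normedModType R} k (A : set V')
    (L : {linear V -> V'}) (f : V' -> W) : open A -> continuous L ->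
  Ck_on k A f -> Ck_on k (L @^-1` A) (fun x => f (L x)).
Proof.
move=> Ao Lc; have Lo : open (L @^-1` A) by apply: open_comp => // x _; exact: Lc.
elim: k f => [|k IH] f /=.
  move=> fc x Ax; apply: (@continuous_comp _ _ _ L f); first exact: Lc.
  exact: fc.
move=> [fd fk].
have D x : A (L x) -> is_diff x (fun z => f (L z)) (fun v => 'd f (L x) (L v)).
  move=> Ax; have fx := differentiableP (fd _ Ax).
  exact: (is_diff_comp (is_diff_linear x Lc) fx).
split=> [x /D[]//|v].
apply: (@Ck_on_ext _ _ _ _ (fun x => 'd f (L x) (L v)) _ Lo _
  (IH _ (fk (L v)))) => x Ax.
exact/esym/(is_diff_val v (D x Ax)).
Qed.

Lemma Ck_on_scale {W : normedModType R} k (A : set R) (f : R -> W) (c : R) :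
  open A -> Ck_on k A f -> Ck_on k [set s | A (c * s)] (fun s => f (c * s)).
Proof.
move=> Ao; pose L : {linear R -> R} := GRing.scale c.
by apply: (@Ck_on_comp_linear _ _ _ k A L f Ao) => x; exact: scaler_continuous.
Qed.

Section Scalars.
Context {V : normedModType R}.
Implicit Types (A : set V) (f g : V -> R) (k : nat).

Lemma Ck_onM k A f g : open A -> Ck_on k A f -> Ck_on k A g ->
  Ck_on k A (fun x => f x * g x).
Proof. by move=> Ao fk gk; exact: (@Ck_onZf _ _ k A f g). Qed.

Lemma Ck_on_prod k A (I : Type) (r : seq I) (f : I -> V -> R) : open A ->
  (forall i, Ck_on k A (f i)) -> Ck_on k A (fun x => \prod_(i <- r) f i x).
Proof.
move=> Ao fk; elim: r => [|i r IH].
  by under eq_fun do rewrite big_nil; exact: Ck_on_cst.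
by under eq_fun do rewrite big_cons; exact: Ck_onM.
Qed.

Lemma Ck_onV k A f : open A -> (forall x, A x -> f x != 0) ->
  Ck_on k A f -> Ck_on k A (fun x => (f x)^-1).
Proof.
move=> Ao f0; elim: k f f0 => [|k IH] f f0.
  by move=> /= fc x Ax; apply: cvgV; [exact: f0|exact: fc].
move=> fS; have [fd fk] := fS; split=> [x Ax|v].
  by apply: differentiableV; [exact: fd|exact: f0].
(* The derivative is written with two factors [(f x)^-1] so that the induction hypothesis applies to
   [f^-1] itself. *)
apply: (@Ck_on_ext _ _ _ _ (fun x => (-1 * ((f x)^-1 * (f x)^-1)) * 'd f x v)) => //.
  move=> x Ax; transitivity (- (f x) ^- 2 * 'd f x v).
    by rewrite mulN1r expr2 invfM.
  exact: (esym (congr1 (@^~ v) (diffV (fd x Ax) (f0 x Ax)))).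
have fV := IH f f0 (Ck_onW fS).
apply: (@Ck_onM _ _ (fun x => -1 * ((f x)^-1 * (f x)^-1)) _ Ao _ (fk v)).
have f2 := Ck_onM Ao fV fV.
exact: (@Ck_onM _ _ (cst (-1)) _ Ao (Ck_on_cst _ _ _) f2).
Qed.

End Scalars.

Section Matrices.
Context {V : normedModType R}.
Implicit Types (A : set V) (k : nat).

Lemma Ck_on_coord k A m n (i : 'I_m) (j : 'I_n) (M : V -> 'M[R]_(m, n)) :
  open A -> Ck_on k A M -> Ck_on k A (fun x => M x i j).
Proof.
move=> Ao Mk.
have @c : {linear 'M[R]_(m, n) -> R}.
  by exists (fun N : 'M[R]_(_, _) => N i j); do 2![eexists]; do ?[constructor];
     rewrite ?mxE// => ? *; rewrite ?mxE//; move=> ?; rewrite !mxE.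
by apply: (@Ck_on_linear_comp _ _ _ k A c) => //; exact: coord_continuous.
Qed.

Lemma Ck_on_mx k A m n (M : V -> 'M[R]_(m, n)) : open A ->
  (forall i j, Ck_on k A (fun x => M x i j)) -> Ck_on k A M.
Proof.
move=> Ao Mk.
have -> : M = fun z => \sum_i \sum_j (M z i j *: delta_mx i j : 'M[R]_(m, n)).
  by apply/funext => z; rewrite -matrix_sum_delta.
apply: Ck_on_sum => // i; apply: Ck_on_sum => // j.
by apply: Ck_onZf => //; exact: Ck_on_cst.
Qed.

Lemma Ck_on_mulmx k A m n p (M : V -> 'M[R]_(m, n)) (N : V -> 'M[R]_(n, p)) :
  open A -> Ck_on k A M -> Ck_on k A N -> Ck_on k A (fun x => M x *m N x).
Proof.
move=> Ao Mk Nk; apply: Ck_on_mx => // i j.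
under eq_fun do rewrite mxE.
by apply: Ck_on_sum => // l; apply: Ck_onM => //; exact: Ck_on_coord.
Qed.

Lemma Ck_on_col_mx k A m1 m2 n (M : V -> 'M[R]_(m1, n)) (N : V -> 'M[R]_(m2, n)) :
  open A -> Ck_on k A M -> Ck_on k A N -> Ck_on k A (fun x => col_mx (M x) (N x)).
Proof.
move=> Ao Mk Nk; apply: Ck_on_mx => // i j; case: (split_ordP i) => l ->.
  by under eq_fun do rewrite col_mxEu; exact: Ck_on_coord.
by under eq_fun do rewrite col_mxEd; exact: Ck_on_coord.
Qed.

Lemma Ck_on_det k A n (M : V -> 'M[R]_n) : open A ->
  (forall i j, Ck_on k A (fun x => M x i j)) -> Ck_on k A (fun x => \det (M x)).
Proof.
move=> Ao Mk; rewrite /determinant; apply: Ck_on_sum => // s.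
by apply: Ck_onM => //; [exact: Ck_on_cst|exact: Ck_on_prod].
Qed.

(** Cramer's rule: the inverse is the adjugate divided by the determinant, both polynomial in the
    entries. *)
Lemma Ck_on_invmx k A n (M : V -> 'M[R]_n) : open A ->
  (forall x, A x -> M x \in unitmx) -> Ck_on k A M ->
  Ck_on k A (fun x => invmx (M x)).
Proof.
move=> Ao Mu Mk; have Mc i j : Ck_on k A (fun x => M x i j).
  exact: Ck_on_coord.
apply: (@Ck_on_ext _ _ _ _ (fun x => (\det (M x))^-1 *: \adj (M x))) => //.
  by move=> x Ax; rewrite /invmx Mu.
apply: Ck_onZf => //.
  apply: Ck_onV => //; last exact: Ck_on_det.
  by move=> x /Mu; rewrite unitmxE unitfE.
apply: Ck_on_mx => // i j.
have -> : (fun x => \adj (M x) i j) =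
    fun x => (-1) ^+ (j + i) * \det (row' j (col' i (M x))).
  by apply/funext => x; rewrite mxE.
apply: Ck_onM => //; first exact: Ck_on_cst.
apply: Ck_on_det => // a b.
by under eq_fun do rewrite !mxE; exact: Mc.
Qed.

End Matrices.

Lemma Ck_on_pair {V W W' : normedModType R} k (A : set V) (f : V -> W)
    (g : V -> W') : open A -> Ck_on k A f -> Ck_on k A g ->
  Ck_on k A (fun x => (f x, g x)).
Proof.
move=> Ao; elim: k f g => [|k IH] f g /=.
  by move=> fc gc x Ax; apply: cvg_pair; [exact: fc|exact: gc].
move=> [fd fk] [gd gk]; split=> [x Ax|v].
  by apply: differentiable_pair; [exact: fd|exact: gd].
apply: (@Ck_on_ext _ _ _ _ (fun x => ('d f x v, 'd g x v)) _ Ao _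
  (IH _ _ (fk v) (gk v))) => x Ax.
exact: (esym (congr1 (@^~ v) (diff_pair (fd x Ax) (gd x Ax)))).
Qed.

Lemma diff_sum_coord {W : normedModType R} n (f : 'cV[R]_n -> W) x v :
  'd f x v = \sum_i v i 0 *: 'd f x (delta_mx i 0).
Proof.
rewrite [in LHS](matrix_sum_delta v) linear_sum; apply: eq_bigr => i _.
by rewrite big_ord1 linearZ.
Qed.

(** [Ck_on] controls differentials in fixed directions only; a direction varying with the point is
    expanded in the standard basis. *)
Lemma Ck_on_diff {V W : normedModType R} n k (A : set V)
    (h : 'cV[R]_n -> W) (g : V -> 'cV[R]_n) (F : V -> 'cV[R]_n) :
  open A -> (forall v, Ck_on k A (fun x => 'd h (g x) v)) -> Ck_on k A F ->
  Ck_on k A (fun x => 'd h (g x) (F x)).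
Proof.
move=> Ao hk Fk; under eq_fun do rewrite diff_sum_coord.
by apply: Ck_on_sum => // i; apply: Ck_onZf => //; exact: Ck_on_coord.
Qed.

Lemma smooth_on_diff {V W : normedModType R} (A : set V) (f : V -> W) v :
  smooth_on A f -> smooth_on A (fun x => 'd f x v).
Proof. by move=> fs k; have [_ fk] := fs k.+1; exact: fk. Qed.

Lemma smooth_on_differentiable {V W : normedModType R} (A : set V) (f : V -> W) x :
  smooth_on A f -> A x -> differentiable f x.
Proof. by move=> fs; have [fd _] := fs 1%N; exact: fd. Qed.

(* Along a solution of z' = F(z) the derivative of h o z is h1 o z, where
   h1 = dh(F) is again smooth. *)
Lemma smooth_integral_curve {W : normedModType R} n (I : set R)
    (O : set 'cV[R]_n) (z : R -> 'cV[R]_n) (F : 'cV[R]_n -> 'cV[R]_n)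
    (h : 'cV[R]_n -> W) : open I -> open O -> smooth_on O F -> smooth_on O h ->
  (forall s, I s -> O (z s)) ->
  (forall s, I s -> is_diff s z (fun v => v *: F (z s))) ->
  smooth_on I (fun s => h (z s)).
Proof.
move=> Io Oo FO hO zO zF k; elim: k h hO => [|k IH] h hO.
  move=> s Is; apply: (@continuous_comp _ _ _ z h).
    by have [/differentiable_continuous] := zF s Is.
  exact/differentiable_continuous/(smooth_on_differentiable hO)/zO.
have D s : I s -> is_diff s (fun s => h (z s)) (fun v => v *: 'd h (z s) (F (z s))).
  move=> Is; have hz := differentiableP (smooth_on_differentiable hO (zO s Is)).
  apply: (is_diff_ext _ _ (is_diff_comp (zF s Is) hz)) => // v /=.
  by rewrite linearZ.
split=> [s /D[]//|v].
apply: (@Ck_on_ext _ _ _ _ (fun s => v *: 'd h (z s) (F (z s)))) => //.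
  by move=> x Ax; exact/esym/(is_diff_val v (D x Ax)).
apply: Ck_onZf => //; first exact: Ck_on_cst.
apply: (IH (fun x => 'd h x (F x))) => j.
apply: (@Ck_on_diff _ _ _ _ _ h id F) => // w.
have [_ hk] := hO j.+1; exact: hk.
Qed.

End Smoothness.

(** * Second differentials along curves *)

Section SecondOrder.
Context {R : realType}.

(** The two terms are the variation of the direction and that of the base point; the second is the
    origin of every [diff2] in the development. *)
Lemma is_diff_diff {V W : normedModType R} n (f : 'cV[R]_n -> W)
    (A : set 'cV[R]_n) (g dg w dw : V -> 'cV[R]_n) x :
  smooth_on A f -> A (g x) -> is_diff x g dg -> is_diff x w dw ->
  is_diff x (fun z => 'd f (g z) (w z))
    (fun v => 'd f (g x) (dw v) + 'd (fun z => 'd f z (w x)) (g x) (dg v)).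
Proof.
move=> fs Ax gd wd.
have fe (i : 'I_n) : is_diff (g x) (fun z => 'd f z (delta_mx i 0))
    ('d (fun z => 'd f z (delta_mx i 0)) (g x)).
  by apply: differentiableP; exact: (smooth_on_differentiable (smooth_on_diff _ fs)).
have T (i : 'I_n) := is_diffZf (is_diff_coord i 0 wd) (is_diff_comp gd (fe i)).
apply: (is_diff_ext _ _ (is_diff_sum (index_enum _) T)) => [z|v] /=.
  by rewrite -diff_sum_coord.
rewrite big_split /= addrC; congr (_ + _); first by rewrite -diff_sum_coord.
(* The coefficients of the direction are now frozen at [x], which identifies the remaining sum as a
   second differential in the direction [w x]. *)
have S (i : 'I_n) := is_diffZf (is_diff_cst (w x i 0) (g x)) (fe i).
have -> : (fun z => 'd f z (w x)) =
    fun z => \sum_i cst (w x i 0) z *: 'd f z (delta_mx i 0).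
  by apply/funext => z; rewrite /= -diff_sum_coord.
apply/esym; apply: etrans (is_diff_val (dg v) (is_diff_sum (index_enum _) S)) _.
by apply: eq_bigr => i _; rewrite scale0r addr0.
Qed.

End SecondOrder.

(* A congruence, because rewriting would try to unify [jac G z] with [jac G y] by
   unfolding both, which does not terminate in practice. *)
Lemma jac_mulmxB {R : realType} n k (G : 'cV[R]_n -> 'cV[R]_k) (z y v : 'cV[R]_n) :
  jac G z *m v - jac G y *m v = 'd G z v - 'd G y v.
Proof. by congr (_ - _); [exact: jac_mulmx G z v|exact: jac_mulmx G y v]. Qed.

(** * Derivatives of curves and of constraints along them *)

Section Curves.
Context {R : realType} {W : normedModType R}.
Implicit Types (I : set R) (y : R -> W).

Lemma smooth_curve_is_diff I y s : smooth_on I y -> I s ->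
  is_diff s y (fun v => v *: (y^`()%classic s)).
Proof.
move=> ys Is; have yd := smooth_on_differentiable ys Is.
by apply: DiffDef => //; rewrite diff1E.
Qed.

Lemma is_diff_derive1 y dy s : is_diff s y dy -> y^`()%classic s = dy 1.
Proof. by case=> yd <-; exact: derive1E'. Qed.

Lemma smooth_derive1 I y : open I -> smooth_on I y -> smooth_on I (y^`()%classic).
Proof.
move=> Io ys k.
have y1 := smooth_on_diff (1 : R) ys k.
apply: (Ck_on_ext Io _ y1).
by move=> s Is; rewrite -derive1E'//; exact: smooth_on_differentiable Is.
Qed.

Lemma near_eq_derive1 y1 y2 s : (\forall t \near s, y1 t = y2 t) ->
  y1^`()%classic s = y2^`()%classic s.
Proof. by move=> ys; rewrite !derive1E; exact: near_eq_derive. Qed.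

End Curves.

Section LevelCurves.
Context {R : realType} {W : normedModType R}.

Lemma level_curve_derive1 n (I : set R) (y : R -> 'cV[R]_n) (G : 'cV[R]_n -> W) c :
  open I -> smooth_on I y -> smooth_on setT G -> (forall s, I s -> G (y s) = c) ->
  forall s, I s -> 'd G (y s) (y^`()%classic s) = 0.
Proof.
move=> Io ys Gs yG s Is.
have yd := smooth_curve_is_diff ys Is.
have Gd := differentiableP (smooth_on_differentiable (x := y s) Gs Logic.I).
have := is_diff_derive1 (is_diff_comp yd Gd).
rewrite /= scale1r => <-; rewrite (@near_eq_derive1 _ _ _ (cst c)) ?derive1_cst//.
by near=> t; apply: yG; near: t; exact: open_nbhs_nbhs.
Unshelve. all: by end_near. Qed.

Lemma level_curve_derive2 n (I : set R) (y : R -> 'cV[R]_n) (G : 'cV[R]_n -> W) c :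
  open I -> smooth_on I y -> smooth_on setT G -> (forall s, I s -> G (y s) = c) ->
  forall s, I s -> 'd G (y s) (y^`()^`()%classic s)
    + diff2 G (y s) (y^`()%classic s) = 0.
Proof.
move=> Io ys Gs yG s Is.
have dG := level_curve_derive1 Io ys Gs yG.
have D := is_diff_diff Gs Logic.I (smooth_curve_is_diff ys Is)
  (smooth_curve_is_diff (smooth_derive1 Io ys) Is).
have := is_diff_derive1 D; rewrite /= !scale1r => <-.
rewrite (@near_eq_derive1 _ _ _ (cst 0)) ?derive1_cst//.
by near=> t; apply: dG; near: t; exact: open_nbhs_nbhs.
Unshelve. all: by end_near. Qed.

End LevelCurves.

(** * Curves in level sets *)

Section StrictDifferentiability.
Context {R : realType}.

Lemma mx_norm_le m n (M : 'M[R]_(m, n)) (e : R) : 0 <= e ->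
  (forall i j, `|M i j| <= e) -> `|M| <= e.
Proof.
move=> e0 Me; rewrite [leLHS]/Num.Def.normr/= mx_normrE.
by apply: bigmax_le => // -[i j] _; exact: Me.
Qed.

Lemma mx_norm_coord m n (M : 'M[R]_(m, n)) i j : `|M i j| <= `|M|.
Proof.
by rewrite [leRHS]/Num.Def.normr/= mx_normrE; exact: (le_bigmax _ _ (i, j)).
Qed.

Lemma mulmx_bounded m n (A : 'M[R]_(m, n)) :
  exists2 K : R, 0 < K & forall v : 'cV[R]_n, `|A *m v| <= K * `|v|.
Proof.
have /linear_lipschitz [K K0 AK] :=
  @mxlin_continuous _ _ _ _ _ (mulmx A : {linear 'cV[R]_n -> 'cV[R]_m}).
by exists K.
Qed.

Lemma is_diff_is_derive {W : normedModType R} (f : R -> W) df x :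
  is_diff x f df -> is_derive x 1 f (df 1).
Proof.
by move=> [fd <-]; apply: DeriveDef; [exact: diff_derivable|exact: deriveE].
Qed.

(** Uniformity in the direction [w] comes from finite dimension: it is enough to control the
    finitely many basis directions. *)
Lemma diff_near_le {W : normedModType R} n (G : 'cV[R]_n -> W) (y0 : 'cV[R]_n) (e : R) :
  smooth_on setT G -> 0 < e -> exists2 rho : R, 0 < rho &
  forall z : 'cV[R]_n, `|z - y0| < rho ->
    forall w : 'cV[R]_n, `|'d G z w - 'd G y0 w| <= e * `|w|.
Proof.
(* Each of the [n] basis directions gets an equal share of [e]; the successor keeps the quotient
   meaningful for [n = 0]. *)
move=> Gs e0; pose d := e / n.+1%:R; have d0 : 0 < d by rewrite divr_gt0.
have H : \forall z \near y0, forall j : 'I_n,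
    `|'d G z (delta_mx j 0) - 'd G y0 (delta_mx j 0)| <= d.
  apply: (@filter_forall _ _ (fun j z =>
    `|'d G z (delta_mx j 0) - 'd G y0 (delta_mx j 0)| <= d) _ (nbhs_filter y0)) => j.
  have /cvgrPdist_le/(_ d d0) Gj :
      {for y0, continuous (fun z => 'd G z (delta_mx j 0))}.
    exact/differentiable_continuous/(smooth_on_differentiable (smooth_on_diff _ Gs)).
  by near=> z; rewrite distrC; near: z.
move/nbhs_normP: H => [rho /= rho0 Hr]; exists rho => // z zr w.
have {}Hr := Hr z; rewrite /= distrC in Hr; have {}Hr := Hr zr.
have -> : 'd G z w - 'd G y0 w =
    \sum_i w i 0 *: ('d G z (delta_mx i 0) - 'd G y0 (delta_mx i 0)).
  under eq_bigr do rewrite scalerBr.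
  rewrite sumrB; congr (_ - _); first exact: diff_sum_coord G z w.
  exact: diff_sum_coord G y0 w.
apply: le_trans (ler_norm_sum _ _ _) _.
apply: (@le_trans _ _ (\sum_(i < n) `|w| * d)).
  apply: ler_sum => i _; rewrite normrZ.
  by apply: ler_pM => //; exact: mx_norm_coord.
rewrite sumr_const card_ord -mulrnAr [leRHS]mulrC ler_wpM2l// /d -mulr_natl.
by rewrite mulrCA ler_piMr ?ltW// ltr_pdivrMr// mul1r ltr_nat.
Unshelve. all: by end_near. Qed.

(** Mean value theorem on the segment from [z'] to [z], for one entry at a time; the norm being the
    sup norm, no constant is lost. *)
Lemma strict_diff n k (G : 'cV[R]_n -> 'cV[R]_k) (y0 : 'cV[R]_n) (e rho : R) :
  smooth_on setT G -> 0 < e ->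
  (forall z : 'cV[R]_n, `|z - y0| < rho ->
    forall w : 'cV[R]_n, `|'d G z w - 'd G y0 w| <= e * `|w|) ->
  forall z z' : 'cV[R]_n, `|z - y0| < rho -> `|z' - y0| < rho ->
  `|G z - G z' - 'd G y0 (z - z')| <= e * `|z - z'|.
Proof.
move=> Gs e0 Gr z z' zr zr'; set w := z - z'.
apply: mx_norm_le => [|i j]; first by rewrite mulr_ge0// ltW.
(* Subtracting the linear part makes the derivative of [f] an entry of the difference of
   differentials that is known to be small. *)
pose f (t : R) := G (z' + t *: w) i j - t * 'd G y0 w i j.
have aux (L1 L2 : {linear 'cV[R]_n -> 'cV[R]_k}) (v : R) :
    L1 (v *: w) i j - v *: L2 w i j = v * (L1 w - L2 w) i j.
  by rewrite linearZ !mxE mulrBr.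
have fD (t : R) : is_derive t 1 f (('d G (z' + t *: w) w - 'd G y0 w) i j).
  have gd : is_diff t (fun t : R => z' + t *: w) (fun v => v *: w).
    apply: (is_diff_ext _ _ (is_diffD (is_diff_cst z' t) (is_diff_scalel t w))) => // v.
    by rewrite /= add0r.
  have Gd := differentiableP (smooth_on_differentiable (x := z' + t *: w) Gs Logic.I).
  have D1 := is_diff_coord i j (is_diff_comp gd Gd).
  have D2 := is_diff_scalel t ('d G y0 w i j).
  have D : is_diff t f (fun v => v * ('d G (z' + t *: w) w - 'd G y0 w) i j).
    apply: (is_diff_ext _ _ (is_diffB D1 D2)) => // v.
    exact: aux.
  by have := is_diff_is_derive D; rewrite mul1r.
have [|c c01] := @MVT_segment R f _ 0 1 ler01 (fun t _ => fD t).
  apply: continuous_subspaceT => t; apply: differentiable_continuous.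
  exact/derivable1_diffP/ex_derive.
rewrite /f subr0 mulr1 mul1r scale1r mul0r subr0 scale0r addr0 addrC.
rewrite /w (addrC z') subrK -/w => fE.
have -> : (G z - G z' - 'd G y0 w) i j = ('d G (z' + c *: w) w - 'd G y0 w) i j.
  by rewrite -fE; move: ('d G y0 w) => a; rewrite !mxE; ring.
apply: le_trans (mx_norm_coord _ _ _) _; apply: Gr.
have -> : z' + c *: w - y0 = (1 - c) *: (z' - y0) + c *: (z - y0).
  by apply/matrixP => a b; rewrite /w !mxE; ring.
move: c01; rewrite in_itv /= => /andP[c0 c1].
apply: le_lt_trans (ler_normD _ _) _; rewrite !normrZ (ger0_norm c0) ger0_norm ?subr_ge0//.
(* Strictness of the inequality comes from [z'] when [c = 0] and from [z] otherwise. *)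
have [->|c0'] := eqVneq c 0; first by rewrite subr0 mul1r mul0r addr0.
have c0p : 0 < c by rewrite lt_def c0'.
have -> : rho = (1 - c) * rho + c * rho by ring.
by rewrite ler_ltD// ?ltr_pM2l// ler_wpM2l ?subr_ge0// ltW.
Qed.

End StrictDifferentiability.

(** * Zeros of a map along a given curve, by contraction *)

Section ImplicitCurves.
Context {R : realType}.

Lemma contraction_fixpoint k (r : R) (f : 'cV[R]_k -> 'cV[R]_k) : 0 <= r ->
  (forall u : 'cV[R]_k, `|u| <= r -> `|f u| <= r) ->
  (forall u v : 'cV[R]_k, `|u| <= r -> `|v| <= r -> `|f u - f v| <= 2^-1 * `|u - v|) ->
  exists2 u : 'cV[R]_k, `|u| <= r & f u = u.
Proof.
move=> r0 fr fc.
pose X : completeNormedModType R := HB.pack 'cV[R]_k.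
pose U : set X := [set u : X | `|u| <= r].
have fU : {homo f : x / U x >-> U x} by move=> u; exact: fr.
pose F : {fun U >-> U} := mkfun fU.
have Fc : is_contraction F.
  have q0 : 0 <= 2^-1 :> R by rewrite invr_ge0.
  exists (NngNum q0); split; first by rewrite /= invf_lt1// ltr1n.
  by move=> [u v] /= [Uu Uv]; exact: fc.
have Uc : closed U.
  apply: (@preimage_closed _ _ (fun x : X => `|x|) [set x | x <= r]).
    by move=> x _; exact: norm_continuous.
  exact: closed_le.
have U0 : U !=set0 by exists 0; rewrite /U /= normr0.
by have [u Uu uE] := banach_fixed_point Fc Uc U0; exists u => //; rewrite {2}uE.
Qed.

(** A Newton iteration with frozen derivative: since dG at [y0] composed with [W] is the identity,
    [u - G (P s + W u)] contracts in [u], and a fixed point is a zero of [G]. The third clause for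
    [y s] says that the correction to [P s] lies in the range of [W]; the Lipschitz bound makes up
    for the arbitrary selection of zeros. *)
Lemma implicit_curve n k (G : 'cV[R]_n -> 'cV[R]_k) (y0 : 'cV[R]_n)
    (W : 'M[R]_(n, k)) (P : R -> 'cV[R]_n) :
  smooth_on setT G -> jac G y0 *m W = 1%:M -> G y0 = 0 ->
  P 0 = y0 -> {for 0, continuous P} ->
  exists (y : R -> 'cV[R]_n) (e C : R), [/\ 0 < e, 0 < C, y 0 = y0,
    forall s, `|s| < e -> [/\ G (y s) = 0, jac G (y s) *m W \in unitmx &
      y s - P s = W *m (jac G y0 *m (y s - P s))] &
    forall s s', `|s| < e -> `|s'| < e -> `|y s - y s'| <= C * `|P s - P s'|].
Proof.
move=> Gs; have JE := jac_mulmx G; have JB := jac_mulmxB G.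
move: (jac G) JE JB => J JE JB DW G0 P0 Pc; set D := J y0 in DW *.
have [K K0 WK] := mulmx_bounded W.
have [KD KD0 DK] := mulmx_bounded D.
(* With this tolerance an error of [e1] times the norm of [W *m u] is at most half the norm of
   [u]. *)
pose e1 := (2 * K)^-1; have e10 : 0 < e1 by rewrite invr_gt0 mulr_gt0.
have e1K : e1 * K = 2^-1 by rewrite /e1 invfM mulfVK// gt_eqF.
have [rho rho0 Gr] := diff_near_le y0 Gs e10.
have half (a b : R) : a <= b -> 2^-1 * a + b / 2 <= b by move=> ab; lra.
have half0 (a : R) : a <= 2^-1 * a -> a <= 0 by move=> ?; lra.
have subBACA (V : zmodType) (a b c d : V) : a - c - (b - d) = - (c - d - (a - b)).
  by rewrite !opprB addrACA [RHS]addrACA (addrC (- c)).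
have str (z z' : 'cV[R]_n) : `|z - y0| < rho -> `|z' - y0| < rho ->
    `|G z - G z' - D *m (z - z')| <= e1 * `|z - z'|.
  by move=> zr zr'; rewrite JE; exact: (strict_diff Gs e10 Gr).
have GrJ (z : 'cV[R]_n) : `|z - y0| < rho ->
    forall w : 'cV[R]_n, `|J z *m w - D *m w| <= e1 * `|w|.
  by move=> zr w; rewrite JB; exact: Gr.
(* Corrections [W *m u] then have norm at most [rho / 4]; with [P s] within [rho / 2] of [y0], all
   points stay in the ball where the strict estimate holds. *)
pose r := rho / (4 * K); have r0 : 0 < r by rewrite divr_gt0// mulr_gt0.
have Kr : K * r = rho / 4.
  by rewrite /r; field; rewrite gt_eqF.
have [e e0 He] : exists2 e : R, 0 < e & forall s, `|s| < e ->
    `|P s - y0| < rho / 2 /\ `|G (P s)| <= r / 2.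
  have H1 : \forall s \near (0 : R), `|P s - y0| < rho / 2.
    move/cvgrPdist_lt: Pc => /(_ (rho / 2)); rewrite P0 => H.
    by near=> s; rewrite distrC; near: s; apply: H; rewrite divr_gt0.
  have H2 : \forall s \near (0 : R), `|G (P s)| <= r / 2.
    have GPc : {for 0, continuous (fun s => G (P s))}.
      apply: (@continuous_comp _ _ _ P G) => //.
      exact/differentiable_continuous/(smooth_on_differentiable Gs).
    move/cvgrPdist_le: GPc => /(_ (r / 2)); rewrite P0 G0 => H.
    near=> s; rewrite -normrN -sub0r; near: s; apply: H.
    by rewrite divr_gt0.
  have H12 : \forall s \near (0 : R), `|P s - y0| < rho / 2 /\ `|G (P s)| <= r / 2.
    by near=> s; split; near: s.
  move/nbhs_normP: H12 => [e /= e0 H]; exists e => // s se.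
  by apply: H; rewrite /= sub0r normrN.
have Wr (u : 'cV[R]_k) : `|u| <= r -> `|W *m u| <= rho / 4.
  by move=> ur; apply: le_trans (WK u) _; rewrite -Kr ler_wpM2l// ltW.
have yr s (u : 'cV[R]_k) : `|s| < e -> `|u| <= r -> `|P s + W *m u - y0| < rho.
  move=> /He[Ps _] /Wr Wu; rewrite addrAC.
  apply: le_lt_trans (ler_normD _ _) _.
  apply: lt_le_trans (ltr_leD Ps Wu) _; lra.
have DWK (u v : 'cV[R]_k) : D *m (W *m u - W *m v) = u - v.
  by rewrite -mulmxBr mulmxA DW mul1mx.
have W2 (u : 'cV[R]_k) : e1 * `|W *m u| <= 2^-1 * `|u|.
  by rewrite -e1K -mulrA ler_wpM2l// ltW.
have ex s : `|s| < e -> exists2 u : 'cV[R]_k, `|u| <= r & G (P s + W *m u) = 0.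
  move=> se; have [_ GP] := He s se.
  have fc (u v : 'cV[R]_k) : `|u| <= r -> `|v| <= r ->
      `|u - G (P s + W *m u) - (v - G (P s + W *m v))| <= 2^-1 * `|u - v|.
    move=> ur vr; have := str _ _ (yr _ _ se ur) (yr _ _ se vr).
    have -> : P s + W *m u - (P s + W *m v) = W *m u - W *m v.
      by rewrite opprD addrACA subrr add0r.
    rewrite DWK -mulmxBr => H; apply: le_trans (W2 (u - v)); apply: le_trans H.
    by rewrite subBACA normrN.
  (* The ball of radius [r] is preserved: the contraction contributes [r / 2], and the value at
     [u = 0], namely [- G (P s)], another [r / 2]. *)
  have [u ur|u ur uE] := @contraction_fixpoint k r (fun u => u - G (P s + W *m u)) (ltW r0) _ fc.
    have nr0 : `|0 : 'cV[R]_k| <= r by rewrite normr0 ltW.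
    have := fc u 0 ur nr0; rewrite mulmx0 addr0 sub0r opprK subr0 => H.
    have -> : u - G (P s + W *m u) = (u - G (P s + W *m u) + G (P s)) - G (P s).
      by rewrite addrK.
    apply: le_trans (ler_normB _ _) _.
    apply: le_trans (lerD H GP) _.
    exact: half.
  by exists u => //; rewrite -[LHS](subKr u) uE subrr.
have /choice[u uP] : forall s, exists u : 'cV[R]_k,
    `|s| < e -> `|u| <= r /\ G (P s + W *m u) = 0.
  move=> s; have [/ex[u ur Gu]|_] := ltP `|s| e; first by exists u.
  by exists 0.
pose y s := P s + W *m u s.
have yP s : y s - P s = W *m u s by rewrite /y [P s + _]addrC addrK.
have Gy s : `|s| < e -> G (y s) = 0 by move=> /uP[].
have yb s : `|s| < e -> `|y s - y0| < rho by move=> se; apply: yr => //; have [] := uP s se.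
(* Both points are zeros of [G], so the strict estimate bounds the linear part of their difference,
   in which [D *m W = 1] isolates [u s - u s']. *)
have strG s s' : `|s| < e -> `|s'| < e ->
    `|D *m (P s - P s') + (u s - u s')| <= e1 * `|y s - y s'|.
  move=> se se'; have := str _ _ (yb s se) (yb s' se').
  rewrite !Gy// subrr sub0r normrN; congr (`|_| <= _).
  by rewrite -DWK -mulmxDr /y opprD addrACA.
have C0 : 0 < 2 * (1 + K * KD) by rewrite mulr_gt0// addr_gt0// mulr_gt0.
exists y, e, (2 * (1 + K * KD)); split => //.
(* [y 0] and [y0] are both zeros of [G] differing by an element of the range of [W]; the strict
   estimate gives |u 0| <= |u 0| / 2, whichever zero was selected. *)
- have e00 : `|0 : R| < e by rewrite normr0.
  have := str _ _ (yb 0 e00) (_ : `|y0 - y0| < rho).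
  rewrite subrr normr0 => /(_ rho0); rewrite Gy// G0 subrr sub0r normrN.
  have -> : y 0 - y0 = W *m u 0 - W *m 0 by rewrite mulmx0 subr0 -yP P0.
  rewrite DWK !subr0 mulmx0 subr0 => /le_trans/(_ (W2 _)) H.
  have -> : y 0 = y0 + W *m u 0 by rewrite /y P0.
  have /eqP : `|u 0| = 0 by apply/eqP; rewrite eq_le normr_ge0 half0.
  by rewrite normr_eq0 => /eqP ->; rewrite mulmx0 addr0.
- move=> s se; split; first exact: Gy.
    (* A kernel vector of [J (y s) *m W] has norm at most half of itself, because this matrix is
       within 1/2 of [D *m W = 1]. *)
    rewrite -unitmx_tr -row_free_unit; apply/inj_row_free => v vA.
    have /(congr1 trmx) := vA; rewrite trmx_mul trmxK trmx0 -mulmxA => {}vA.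
    have := GrJ _ (yb s se) (W *m v^T); rewrite (mulmxA D) DW mul1mx vA sub0r normrN.
    move=> /le_trans/(_ (W2 _))/half0; rewrite normr_le0 => /eqP vT.
    by rewrite -[v]trmxK vT trmx0.
  by rewrite yP (mulmxA D) DW mul1mx.
move=> s s' se se'; have H := strG s s' se se'.
have yE : y s - y s' = P s - P s' + W *m (u s - u s').
  by rewrite mulmxBr /y opprD addrACA.
have H1 : `|y s - y s'| <= `|P s - P s'| + K * `|u s - u s'|.
  by rewrite yE; apply: le_trans (ler_normD _ _) _; rewrite lerD2l.
have H2 : `|u s - u s'| <= e1 * `|y s - y s'| + KD * `|P s - P s'|.
  have -> : u s - u s' = (D *m (P s - P s') + (u s - u s')) - D *m (P s - P s').
    by rewrite [RHS]addrAC subrr add0r.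
  by apply: le_trans (ler_normB _ _) _; apply: lerD.
(* By the choice of [e1], the term in |y s - y s'| has coefficient 1/2 and is absorbed on the left;
   this doubles the rest and explains the constant [2 * (1 + K * KD)]. *)
have H3 : K * `|u s - u s'| <= K * (e1 * `|y s - y s'| + KD * `|P s - P s'|).
  by rewrite ler_wpM2l// ltW.
have H4 : K * (e1 * `|y s - y s'| + KD * `|P s - P s'|) =
    2^-1 * `|y s - y s'| + K * KD * `|P s - P s'| by rewrite -e1K; ring.
rewrite H4 in H3.
have fin (a p b c : R) : a <= p + c -> c <= 2^-1 * a + b * p -> a <= 2 * (1 + b) * p.
  by move=> *; lra.
exact: fin H1 H3.
Unshelve. all: by end_near. Qed.

End ImplicitCurves.

(** * Differentiability of the implicit curve *)

Section SmoothImplicitCurves.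
Context {R : realType}.

Lemma is_diff_curve_eps {V : normedModType R} (f : R -> V) x q :
  (forall e : R, 0 < e ->
     \forall h \near (0 : R), `|f (h + x) - f x - h *: q| <= e * `|h|) ->
  is_diff x f (fun v => v *: q).
Proof.
have lin : linear ( *:%R ^~ q : R -> V).
  by move=> u a b; rewrite scalerDl scalerA.
pose LM := GRing.isLinear.Build _ _ _ _ _ lin.
pose L : {linear R -> V} := HB.pack ( *:%R ^~ q) LM.
move=> H; apply: (@is_diff_eps _ _ _ f x L) => //.
exact: scalel_continuous.
Qed.

Lemma smooth_on_jac n k (f : 'cV[R]_n -> 'cV[R]_k) (A : set 'cV[R]_n) :
  open A -> smooth_on A f -> smooth_on A (jac f).
Proof.
move=> Ao fs m; apply: Ck_on_mx => // i j; rewrite /jac.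
under eq_fun do rewrite mxE.
exact/Ck_on_coord/(smooth_on_diff _ fs).
Qed.

(** [Q = 1 - W (J W)^-1 J] is the projection onto the kernel of [J] along the range of [W]. It kills
    the uncontrolled increment of [u], and the complementary part of the increment of [y] is of
    smaller order because [G] vanishes along [y]. So the derivative of [y] is that of [P],
    projected. *)
Lemma implicit_curve_diff n k (G : 'cV[R]_n -> 'cV[R]_k) (W : 'M[R]_(n, k))
    (P y : R -> 'cV[R]_n) (u : R -> 'cV[R]_k) (C s : R) (p : 'cV[R]_n)
    (J : 'M[R]_(k, n)) :
  is_diff (y s) G (mulmx J) -> J *m W \in unitmx -> 0 < C ->
  (\forall h \near (0 : R), [/\ G (y (h + s)) = 0,
    y (h + s) = P (h + s) + W *m u (h + s) &
    `|y (h + s) - y s| <= C * `|P (h + s) - P s|]) ->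
  is_diff s P (fun v => v *: p) ->
  is_diff s y (fun v => v *: ((1%:M - W *m invmx (J *m W) *m J) *m p)).
Proof.
move=> [Gd GJ] JW C0 Hy [Pd PdE].
set B := W *m invmx _; set Q := 1%:M - _.
have QW : Q *m W = 0.
  by rewrite mulmxBl mul1mx -!mulmxA mulVmx// mulmx1 subrr.
have QB (v : 'cV[R]_n) : Q *m v + B *m (J *m v) = v.
  by rewrite mulmxA -mulmxDl subrK mul1mx.
have [KQ KQ0 QK] := mulmx_bounded Q; have [KB KB0 BK] := mulmx_bounded B.
apply: is_diff_curve_eps => e e0.
(* [K] is a Lipschitz constant of [y] at [s]: [C] compares it with [P], whose increment is at most
   (1 + |p|) |h| for small [h]. *)
pose K := C * (1 + `|p|); have K0 : 0 < K by rewrite mulr_gt0// ltr_pwDl.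
have H1 : \forall h \near (0 : R), `|P (h + s) - P s - h *: p| <= 1 * `|h|.
  by have := diff_eps Pd ltr01; rewrite PdE.
(* This tolerance and the next make each of the two error terms at the end equal to half of [e]
   times |h|. *)
have H2 : \forall h \near (0 : R), `|P (h + s) - P s - h *: p| <= e / (2 * KQ) * `|h|.
  have e1 : 0 < e / (2 * KQ) by rewrite divr_gt0// mulr_gt0.
  by have := diff_eps Pd e1; rewrite PdE.
have H3 : \forall h \near (0 : 'cV[R]_n),
    `|G (h + y s) - G (y s) - J *m h| <= e / (2 * KB * K) * `|h|.
  have e1 : 0 < e / (2 * KB * K) by rewrite divr_gt0// !mulr_gt0.
  by have := diff_eps Gd e1; rewrite GJ.
move/nbhs_normP: H3 => [d /= d0 H3].
have [Gs ys _] := nbhs_singleton Hy; rewrite add0r in Gs ys.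
have Hd : \forall h \near (0 : R), K * `|h| < d.
  apply/nbhs_normP; exists (d / K) => /= [|h]; first by rewrite divr_gt0.
  by rewrite /= sub0r normrN ltr_pdivlMr// mulrC.
near=> h.
have [Gh yh yC] : [/\ G (y (h + s)) = 0, y (h + s) = P (h + s) + W *m u (h + s) &
    `|y (h + s) - y s| <= C * `|P (h + s) - P s|] by near: h.
have h1 : `|P (h + s) - P s - h *: p| <= 1 * `|h| by near: h.
have h2 : `|P (h + s) - P s - h *: p| <= e / (2 * KQ) * `|h| by near: h.
have hd : K * `|h| < d by near: h.
set Dy := y (h + s) - y s in yC *; set DP := P (h + s) - P s in yC h1 h2.
have DPh : `|DP| <= (1 + `|p|) * `|h|.
  have -> : DP = (DP - h *: p) + h *: p by rewrite subrK.
  apply: le_trans (ler_normD _ _) _.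
  by rewrite mulrDl lerD// normrZ mulrC.
have DyK : `|Dy| <= K * `|h|.
  by apply: le_trans yC _; rewrite /K -mulrA ler_wpM2l// ltW.
have JD : `|J *m Dy| <= e / (2 * KB * K) * `|Dy|.
  have := H3 Dy; rewrite /= sub0r normrN => /(_ (le_lt_trans DyK hd)).
  by rewrite /Dy subrK Gh Gs subr0 sub0r normrN.
have DyE : Dy = DP + W *m (u (h + s) - u s).
  by rewrite /Dy /DP yh ys opprD addrACA mulmxBr.
have -> : Dy - h *: (Q *m p) = Q *m (DP - h *: p) + B *m (J *m Dy).
  rewrite -{1}(QB Dy) {1}DyE (mulmxDr Q DP) [Q *m (W *m _)]mulmxA QW mul0mx addr0.
  by rewrite (mulmxBr Q DP) -scalemxAr addrAC.
have T1 : `|Q *m (DP - h *: p)| <= KQ * (e / (2 * KQ) * `|h|).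
  by apply: le_trans (QK _) _; rewrite ler_wpM2l// ltW.
have T2 : `|B *m (J *m Dy)| <= KB * (e / (2 * KB * K) * (K * `|h|)).
  apply: le_trans (BK _) _; rewrite ler_wpM2l ?(ltW KB0)//.
  apply: le_trans JD _; rewrite ler_wpM2l// ltW// divr_gt0// !mulr_gt0//.
apply: le_trans (ler_normD _ _) _; apply: le_trans (lerD T1 T2) _.
rewrite le_eqVlt; apply/orP; left; apply/eqP; field.
by rewrite !gt_eqF.
Unshelve. all: by end_near. Qed.

End SmoothImplicitCurves.

(** * Smooth curves with prescribed 2-jet in a level set *)

Section LevelSets.
Context {R : realType}.

Lemma Ck_on_mxlin {V : normedModType R} k (A : set V) m n p q
    (L : {linear 'M[R]_(m, n) -> 'M[R]_(p, q)}) (f : V -> 'M[R]_(m, n)) :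
  open A -> Ck_on k A f -> Ck_on k A (fun x => L (f x)).
Proof. by move=> Ao; apply: Ck_on_linear_comp => //; exact: mxlin_continuous. Qed.

Lemma Ck_on_id {V : normedModType R} k (A : set V) : Ck_on k A (@id V).
Proof. by apply: (@Ck_on_linear _ _ _ k A idfun) => x; exact: cvg_id. Qed.

Lemma quadratic_is_diff {V : normedModType R} (y0 y1 y2 : V) (s : R) :
  is_diff s (fun s : R => y0 + s *: y1 + (s ^+ 2 / 2) *: y2)
    (fun v => v *: (y1 + s *: y2)).
Proof.
have D1 := is_diffD (is_diff_cst y0 s) (is_diff_scalel s y1).
have sq : is_diff s (fun s : R => s ^+ 2 / 2) (fun v => v * s).
  have D := is_diffM (is_diff_id s) (is_diff_id s).
  apply: (is_diff_ext _ _ (is_diffZ 2^-1 D)) => [z|v].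
    by rewrite -[LHS]/(2^-1 * (z * z)) mulrC expr2.
  rewrite /= -[LHS]/(2^-1 * (s * v + s * v)); by field.
apply: (is_diff_ext _ _ (is_diffD D1 (is_diffZf sq (is_diff_cst y2 s)))) => // v.
by rewrite !fctE /= scaler0 !add0r scalerDr scalerA.
Qed.

(** The curve corrects the quadratic polynomial with the prescribed 2-jet by elements of the range
    of [W]. The hypotheses on [y1] and [y2] say that this polynomial satisfies the constraint to
    second order at 0, so the correction does not disturb the 2-jet. *)
Lemma level_curve n k (G : 'cV[R]_n -> 'cV[R]_k) (y0 y1 y2 : 'cV[R]_n)
    (W : 'M[R]_(n, k)) :
  smooth_on setT G -> jac G y0 *m W = 1%:M -> G y0 = 0 ->
  jac G y0 *m y1 = 0 -> jac G y0 *m y2 + diff2 G y0 y1 = 0 ->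
  exists (y : R -> 'cV[R]_n) (e : R), [/\ 0 < e, smooth_on `]-e, e[ y,
    forall s, s \in `]-e, e[ -> G (y s) = 0 &
    [/\ y 0 = y0, y^`()%classic 0 = y1 & y^`()^`()%classic 0 = y2]].
Proof.
move=> Gs JW G0 J1 J2.
pose P (s : R) := y0 + s *: y1 + (s ^+ 2 / 2) *: y2.
have Pd s : is_diff s P (fun v => v *: (y1 + s *: y2)) by exact: quadratic_is_diff.
have P0 : P 0 = y0 by rewrite /P expr0n mul0r !scale0r !addr0.
have Pc : {for 0, continuous P} by exact/differentiable_continuous/(@ex_diff _ _ _ _ _ _ _ (Pd 0)).
have [y [e [C [e0 C0 y0E]]]] := implicit_curve Gs JW G0 P0 Pc.
have JE := jac_mulmx G; have Js := smooth_on_jac openT Gs.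
have Gd z : is_diff z G (mulmx (jac G z)).
  have Gz := differentiableP (smooth_on_differentiable (x := z) Gs Logic.I).
  by apply: (is_diff_ext _ _ Gz) => // v; rewrite JE.
move: (jac G) JE Js Gd JW J1 J2 => J JE Js Gd JW J1 J2 yP yC.
pose Q z := 1%:M - W *m invmx (J z *m W) *m J z.
have eI s : s \in `]-e, e[ -> `|s| < e by rewrite in_itv /= ltr_norml.
have Io : open [set` `]-e, e[] by exact: interval_open.
have I0 : (0 : R) \in `]-e, e[ by rewrite in_itv /= oppr_lt0 e0.
have yd s : s \in `]-e, e[ ->
    is_diff s y (fun v => v *: (Q (y s) *m (y1 + s *: y2))).
  move=> sI; have se := eI s sI; have [_ yu _] := yP s se.
  apply: (implicit_curve_diff (u := fun s => J y0 *m (y s - P s)) (Gd (y s)) yu C0 _ (Pd s)).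
  have H : \forall h \near (0 : R), `|h + s| < e.
    apply/nbhs_normP; exists (e - `|s|) => /= [|h]; first by rewrite subr_gt0.
    rewrite /= sub0r normrN ltrBrDr; exact/le_lt_trans/ler_normD.
  near=> h; have he : `|h + s| < e by near: h.
  have [Gh _ yh] := yP _ he; split => //; last exact: yC.
  by rewrite -yh [RHS]addrC subrK.
(* The ODE for [y] depends on [s]; time is adjoined as a coordinate to make it autonomous, as
   [smooth_integral_curve] requires. *)
pose z (s : R) : 'cV[R]_(1 + n) := col_mx (const_mx s) (y s).
pose F (Z : 'cV[R]_(1 + n)) : 'cV[R]_(1 + n) :=
  col_mx (const_mx 1) (Q (dsubmx Z) *m (y1 + usubmx Z 0 0 *: y2)).
pose O := [set Z : 'cV[R]_(1 + n) | J (dsubmx Z) *m W \in unitmx].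
have JZ k' : Ck_on k' setT (fun Z : 'cV[R]_(1 + n) => J (dsubmx Z)).
  pose dL : {linear 'cV[R]_(1 + n) -> 'cV[R]_n} := dsubmx.
  exact: (Ck_on_comp_linear (L := dL) openT (@mxlin_continuous _ _ _ _ _ dL) (Js k')).
have JWk k' : Ck_on k' setT (fun Z : 'cV[R]_(1 + n) => J (dsubmx Z) *m W).
  by apply: (Ck_on_mulmx openT (JZ k')); exact: Ck_on_cst.
have Oo : open O.
  have -> : O = (fun Z : 'cV[R]_(1 + n) => \det (J (dsubmx Z) *m W)) @^-1` [set x | x != 0].
    by apply/seteqP; split => Z; rewrite /O /= unitmxE unitfE.
  apply: open_comp; last exact: open_neq.
  move=> Z _; have dc : Ck_on 0 setT (fun Z : 'cV[R]_(1 + n) => \det (J (dsubmx Z) *m W)).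
    by apply: (Ck_on_det openT) => i j; exact: (Ck_on_coord _ _ openT (JWk 0%N)).
  exact: dc.
have Fs : smooth_on O F.
  move=> k'.
  have JO := Ck_on_sub (@subsetT _ O) (JZ k').
  have JWO := Ck_on_sub (@subsetT _ O) (JWk k').
  have iO := Ck_on_invmx Oo (fun Z OZ => OZ) JWO.
  have idO := @Ck_on_id _ k' O.
  apply: (Ck_on_col_mx Oo); first exact: Ck_on_cst.
  apply: (Ck_on_mulmx Oo).
    have T := Ck_on_mulmx Oo (Ck_on_mulmx Oo (Ck_on_cst k' O W) iO) JO.
    have T' := Ck_onZf Oo (Ck_on_cst k' O (-1 : R)) T.
    apply: (Ck_on_ext Oo _ (Ck_onD Oo (Ck_on_cst k' O (1%:M : 'M[R]_n)) T')) => Z _.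
    by rewrite scaleN1r.
  apply: (Ck_onD Oo); first exact: Ck_on_cst.
  apply: (Ck_onZf Oo); last exact: Ck_on_cst.
  exact: (Ck_on_coord _ _ Oo (Ck_on_mxlin usubmx Oo idO)).
have zO s : [set` `]-e, e[] s -> O (z s).
  by move=> /eI/yP[_ + _]; rewrite /O /z /= col_mxKd.
have zF s : [set` `]-e, e[] s -> is_diff s z (fun v => v *: F (z s)).
  move=> sI; rewrite /F /z col_mxKd col_mxKu mxE.
  have cd : is_diff s (fun s => const_mx s : 'cV[R]_1) (fun v => const_mx v).
    apply: is_diff_mx => i j.
    by apply: (is_diff_ext _ _ (is_diff_id s)) => v; rewrite mxE.
  apply: (is_diff_ext _ _ (is_diff_col_mx cd (yd s sI))) => // v.
  by rewrite scale_col_mx; congr col_mx; apply/matrixP => i j; rewrite !mxE mulr1.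
have ys : smooth_on [set` `]-e, e[] y.
  have ds : smooth_on O (dsubmx : 'cV[R]_(1 + n) -> 'cV[R]_n).
    by move=> k'; apply: (@Ck_on_linear _ _ _ k' O dsubmx); exact: mxlin_continuous.
  have := smooth_integral_curve Io Oo Fs ds zO zF.
  by rewrite (_ : (fun s => _) = y)//; apply/funext => s; exact: col_mxKd.
have y'E s : s \in `]-e, e[ -> y^`()%classic s = Q (y s) *m (y1 + s *: y2).
  by move=> sI; rewrite (is_diff_derive1 (yd s sI)) scale1r.
have y'0 : y^`()%classic 0 = y1.
  by rewrite y'E// scale0r addr0 y0E /Q mulmxBl mul1mx -(mulmxA _ (J y0)) J1 mulmx0 subr0.
exists y, e; split => //; first by move=> s /eI/yP[].
split => //.
have Gy s : [set` `]-e, e[] s -> G (y s) = 0 by move=> /eI/yP[].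
have := level_curve_derive2 Io ys Gs Gy I0.
rewrite -JE y0E y'0; set y'' := y^`()^`()%classic 0 => y''E.
(* [L] projects onto the range of [W] along the kernel of [J y0]. It fixes y' - P' at every time,
   hence y'' - y2 at 0; but that vector is in the kernel, as both accelerations satisfy the twice
   differentiated constraint, so it is zero. *)
pose L := W *m J y0.
have rel s : s \in `]-e, e[ -> y^`()%classic s - (y1 + s *: y2) =
    L *m (y^`()%classic s - (y1 + s *: y2)).
  move=> sI; rewrite y'E// mulmxBl mul1mx addrAC subrr add0r.
  have -> : W *m invmx (J (y s) *m W) *m J (y s) *m (y1 + s *: y2) =
      W *m (invmx (J (y s) *m W) *m (J (y s) *m (y1 + s *: y2))) by rewrite !mulmxA.
  by rewrite mulmxN /L (mulmxA (W *m _)) -(mulmxA W (J y0)) JW mulmx1.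
have pd : is_diff (0 : R) (fun s : R => y1 + s *: y2) (fun v => v *: y2).
  apply: (is_diff_ext _ _ (is_diffD (is_diff_cst y1 0) (is_diff_scalel 0 y2))) => // v.
  by rewrite !fctE add0r.
have dd := is_diffB (smooth_curve_is_diff (smooth_derive1 Io ys) I0) pd.
have E : y'' - y2 = L *m (y'' - y2).
  have := is_diff_derive1 (is_diff_mxlin (mulmx L) dd).
  rewrite /= !fctE !scale1r => <-.
  have := is_diff_derive1 dd; rewrite !fctE !scale1r => <-.
  apply: near_eq_derive1; near=> s; apply: rel.
  by near: s; exact: open_nbhs_nbhs.
apply/eqP; rewrite -subr_eq0 E -mulmxA mulmxBr.
have -> : J y0 *m y'' = J y0 *m y2.
  by apply: (addIr (diff2 G y0 y1)); rewrite y''E J2.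
by rewrite subrr mulmx0.
Unshelve. all: by end_near. Qed.


End LevelSets.

(** * The matrix H and the saddle-point system *)

Section LinearAlgebra.
Context {R : realType}.

(** [Hmx] addresses the entries through [inord]; bringing all sums to these same atoms lets [ring]
    decide the identities below. *)
Lemma col4E (t : 'cV[R]_4) (i : 'I_4) :
  t i 0 = [:: t (inord 0) 0; t (inord 1) 0; t (inord 2) 0; t (inord 3) 0]`_i.
Proof.
by case: i => [[|[|[|[|//]]]] /= li]; congr (t _ _); apply: val_inj => /=;
   rewrite inordK.
Qed.

Lemma dot4E (t u : 'cV[R]_4) : dot t u =
  t (inord 0) 0 * u (inord 0) 0 + t (inord 1) 0 * u (inord 1) 0 +
  t (inord 2) 0 * u (inord 2) 0 + t (inord 3) 0 * u (inord 3) 0.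
Proof.
rewrite /dot mxE; under eq_bigr do rewrite mxE (col4E t) (col4E u).
by rewrite !big_ord_recl big_ord0 /= addr0 !addrA.
Qed.

(** [Hmx t *m u] is the vector part of the quaternion product of the conjugate of [t] with [u];
    exchanging the factors conjugates the product. *)
Lemma Hmx_mulC (t u : 'cV[R]_4) : Hmx t *m u = - (Hmx u *m t).
Proof.
apply/matrixP => i j; rewrite (ord1 j) !mxE.
under eq_bigr do rewrite mxE (col4E u).
under [in RHS]eq_bigr do rewrite mxE (col4E t).
rewrite !big_ord_recl !big_ord0 /=.
by case: i => [[|[|[|//]]] /= _]; ring.
Qed.

Lemma Hmx_self (t : 'cV[R]_4) : Hmx t *m t = 0.
Proof.
have /eqP := Hmx_mulC t t.
by rewrite -addr_eq0 -mulr2n -scaler_nat scaler_eq0 pnatr_eq0 => /eqP.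
Qed.

Lemma Hmx_mul_tr (t : 'cV[R]_4) : Hmx t *m (Hmx t)^T = (dot t t)%:M.
Proof.
apply/matrixP => i j; rewrite !mxE dot4E.
under eq_bigr do rewrite !mxE.
rewrite !big_ord_recl !big_ord0 /= -(inj_eq val_inj).
by case: i => [[|[|[|//]]] /= _]; case: j => [[|[|[|//]]] /= _];
   rewrite ?mulr1n ?mulr0n; ring.
Qed.

(** The vector [t] and the three rows of [Hmx t] are orthogonal and of the same length, so for unit
    [t] this is the projection onto the tangent space of the sphere. *)
Lemma Hmx_tr_mul (t : 'cV[R]_4) :
  (Hmx t)^T *m Hmx t = (dot t t)%:M - t *m t^T.
Proof.
apply/matrixP => i j; rewrite !mxE dot4E big_ord1 mxE (col4E t i) (col4E t j).
under eq_bigr do rewrite !mxE.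
rewrite !big_ord_recl !big_ord0 /= -(inj_eq val_inj).
by case: i => [[|[|[|[|//]]]] /= _]; case: j => [[|[|[|[|//]]]] /= _];
   rewrite ?mulr1n ?mulr0n; ring.
Qed.

Lemma Hmx_is_linear : linear (@Hmx R).
Proof.
move=> a t u; apply/matrixP => i j; rewrite !mxE.
by case: i => [[|[|[|//]]] /= _]; case: j => [[|[|[|[|//]]]] /= _];
   rewrite ?mxE; ring.
Qed.
HB.instance Definition _ :=
  GRing.isLinear.Build R 'cV[R]_4 'M[R]_(3, 4) _ (@Hmx R) Hmx_is_linear.

Lemma dotC n (u v : 'cV[R]_n) : dot u v = dot v u.
Proof. by rewrite /dot !mxE; apply: eq_bigr => i _; rewrite !mxE mulrC. Qed.

Lemma dotDr n (u v w : 'cV[R]_n) : dot u (v + w) = dot u v + dot u w.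
Proof. by rewrite /dot mulmxDr mxE. Qed.

Lemma dotZr n a (u v : 'cV[R]_n) : dot u (a *: v) = a * dot u v.
Proof. by rewrite /dot -scalemxAr mxE. Qed.

Lemma dotNr n (u v : 'cV[R]_n) : dot u (- v) = - dot u v.
Proof. by rewrite -scaleN1r dotZr mulN1r. Qed.

Lemma dot_mulmxr n m (u : 'cV[R]_n) (A : 'M[R]_(n, m)) v :
  dot u (A *m v) = dot (A^T *m u) v.
Proof. by rewrite /dot trmx_mul trmxK mulmxA. Qed.

Lemma dot_mulmxl n m (A : 'M[R]_(n, m)) u (v : 'cV[R]_n) :
  dot (A *m u) v = dot u (A^T *m v).
Proof. by rewrite dotC dot_mulmxr dotC. Qed.

Lemma dotDl n (u v w : 'cV[R]_n) : dot (u + v) w = dot u w + dot v w.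
Proof. by rewrite dotC dotDr !(dotC w). Qed.

Lemma dotZl n a (u v : 'cV[R]_n) : dot (a *: u) v = a * dot u v.
Proof. by rewrite dotC dotZr dotC. Qed.

Lemma dot0l n (v : 'cV[R]_n) : dot 0 v = 0.
Proof. by rewrite dotC /dot mulmx0 mxE. Qed.

Lemma dot_col_mx n m (a b : 'cV[R]_n) (c d : 'cV[R]_m) :
  dot (col_mx a c) (col_mx b d) = dot a b + dot c d.
Proof. by rewrite /dot tr_col_mx mul_row_col mxE. Qed.

Lemma dot_ge0 n (v : 'cV[R]_n) : 0 <= dot v v.
Proof.
by rewrite /dot mxE; apply: sumr_ge0 => i _; rewrite mxE -expr2 sqr_ge0.
Qed.

Lemma dot_gt0 n (v : 'cV[R]_n) : v != 0 -> 0 < dot v v.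
Proof.
move=> v0; rewrite lt_def dot_ge0 andbT; apply: contra v0 => /eqP.
rewrite /dot mxE => v0; apply/eqP/matrixP => i j; rewrite (ord1 j) [RHS]mxE.
have nn (k : 'I_n) : true -> 0 <= v^T 0 k * v k 0 by rewrite mxE -expr2 sqr_ge0.
have /eqP := psumr_eq0P nn v0 (i := i) isT.
by rewrite mxE -expr2 sqrf_eq0 => /eqP.
Qed.

Lemma dot_delta n (u : 'cV[R]_n) i : dot u (delta_mx i 0) = u i 0.
Proof. by rewrite /dot -colE !mxE. Qed.

Lemma mulmx_fix_eq1 n (A : 'M[R]_n) : (forall v : 'cV[R]_n, A *m v = v) -> A = 1%:M.
Proof.
move=> H; apply/matrixP => i j.
have /(congr1 (fun w : 'cV[R]_n => w i 0)) := H (delta_mx j 0).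
by rewrite -colE !mxE eqxx andbT.
Qed.

(** On the kernel, pairing the first line with [d] gives <d, E d> = - <A d, lambda> = 0, so [d = 0]
    by positivity; then the transpose of [A] kills lambda, and full row rank gives [lambda = 0]. *)
Lemma saddle_unique n l (E : 'M[R]_n) (A : 'M[R]_(l, n)) b c :
  (forall v : 'cV[R]_n, v != 0 -> 0 < dot v (E *m v)) -> \rank A = l ->
  exists! dl : 'cV[R]_n * 'cV[R]_l,
    E *m dl.1 + A^T *m dl.2 = b /\ A *m dl.1 = c.
Proof.
move=> Epos rA; pose M := block_mx E A^T A (0 : 'M[R]_l).
have ME d la : M *m col_mx d la = col_mx (E *m d + A^T *m la) (A *m d).
  by rewrite mul_block_col mul0mx addr0.
have Mu : M \in unitmx.
  rewrite -unitmx_tr -row_free_unit; apply/inj_row_free => v vM.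
  have : M *m v^T = 0 by rewrite -[M]trmxK -trmx_mul vM trmx0.
  rewrite -(vsubmxK v^T) ME -col_mx0 => /eq_col_mx[E0 A0].
  set d := usubmx v^T in E0 A0 *; set la := dsubmx v^T in E0 *.
  have d0 : d = 0.
    apply/eqP; apply: contraT => /Epos; suff -> : dot d (E *m d) = 0 by rewrite ltxx.
    have -> : E *m d = - (A^T *m la) by apply/eqP; rewrite -addr_eq0 E0.
    by rewrite -mulmxN dot_mulmxr trmxK A0 /dot trmx0 mul0mx mxE.
  have la0 : la = 0.
    have Al : la^T *m A = 0.
      by move: E0; rewrite d0 mulmx0 add0r => /(congr1 trmx);
         rewrite trmx_mul trmxK trmx0.
    have fA : row_free A by rewrite /row_free rA.
    by apply: trmx_inj; rewrite trmx0; apply: (row_free_inj fA); rewrite Al mul0mx.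
  by apply: trmx_inj; rewrite -(vsubmxK v^T) -/d -/la d0 la0 col_mx0 trmx0.
pose x := invmx M *m col_mx b c.
exists (usubmx x, dsubmx x); split => [|[d la]] /=.
  apply: eq_col_mx; rewrite -ME vsubmxK /x mulKVmx//.
move=> [Eb Ac].
have -> : x = col_mx d la by rewrite /x -Eb -Ac -ME mulKmx.
by rewrite col_mxKu col_mxKd.
Qed.

End LinearAlgebra.

(** * Symmetry of the second differential *)

Section SymmetricSecondDifferential.
Context {R : realType} {V : normedModType R}.

Lemma is_diff_line {W : normedModType R} (f : V -> W) (p u : V) (s : R) :
  differentiable f (p + s *: u) ->
  is_diff s (fun t : R => f (p + t *: u)) (fun c => c *: 'd f (p + s *: u) u).
Proof.
move=> /differentiableP fd.
have gd : is_diff s (fun t : R => p + t *: u) (fun c => c *: u).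
  apply: (is_diff_ext _ _ (is_diffD (is_diff_cst p s) (is_diff_scalel s u))) => // c.
  by rewrite !fctE add0r.
apply: (is_diff_ext _ _ (is_diff_comp gd fd)) => // c.
exact: linearZ.
Qed.

Lemma MVT_line (f : V -> R) (p u : V) (h : R) : 0 <= h ->
  (forall s, 0 <= s <= h -> differentiable f (p + s *: u)) ->
  exists2 s, 0 <= s <= h & f (p + h *: u) - f p = h * 'd f (p + s *: u) u.
Proof.
move=> h0 fd; pose g (t : R) := f (p + t *: u).
have gd s : 0 <= s <= h -> is_diff s g (fun c => c *: 'd f (p + s *: u) u).
  by move=> /fd; exact: is_diff_line.
have [s|t|s sh gE] := @MVT_segment R g (fun s => 'd f (p + s *: u) u) 0 h h0.
- rewrite in_itv /= => /andP[s0 sh].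
  have := is_diff_is_derive (gd s _); rewrite scale1r; apply.
  by rewrite (ltW s0) (ltW sh).
- apply: derivable_within_continuous => s; rewrite in_itv /= => /gd[gs _].
  exact/derivable1_diffP.
- exists s; first by move: sh; rewrite in_itv.
  by move: gE; rewrite /g scale0r addr0 subr0 mulrC.
Qed.

(** Mean value theorem twice: along [u] for the increment of [f] by [h *: v], then along [v] for the
    derivative so obtained. *)
Lemma second_difference (A : set V) (f : V -> R) (x u v : V) (h : R) :
  smooth_on A f -> 0 <= h ->
  (forall s t, 0 <= s <= h -> 0 <= t <= h -> A (x + s *: u + t *: v)) ->
  exists s t, [/\ 0 <= s <= h, 0 <= t <= h &
    f (x + h *: u + h *: v) - f (x + h *: u) - f (x + h *: v) + f x =
    h ^+ 2 * 'd (fun z => 'd f z u) (x + s *: u + t *: v) v].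
Proof.
move=> fs h0 Ah; have hh : 0 <= h <= h by apply/andP.
have h00 : 0 <= (0 : R) <= h by apply/andP.
pose g z := f (z + h *: v) - f z.
have gd s : 0 <= s <= h -> is_diff (x + s *: u) g
    (fun w => 'd f (x + s *: u + h *: v) w - 'd f (x + s *: u) w).
  move=> sh; apply: is_diffB; last first.
    apply/differentiableP/(smooth_on_differentiable fs).
    by have := Ah s 0 sh h00; rewrite scale0r addr0.
  have fd := differentiableP (smooth_on_differentiable fs (Ah s h sh hh)).
  have sd : is_diff (x + s *: u) (fun z => z + h *: v) id.
    apply: (is_diff_ext _ _ (is_diffD (is_diff_id (x + s *: u))
      (is_diff_cst (h *: v) _))) => // w.
    by rewrite fctE addr0.
  exact: (is_diff_comp sd fd).
have [|s sh gE] := @MVT_line g x u h h0; first by move=> s /gd[].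
have [|t th kE] := @MVT_line (fun z => 'd f z u) (x + s *: u) v h h0.
  by move=> t th; exact: (smooth_on_differentiable (smooth_on_diff u fs)) (Ah s t sh th).
exists s, t; split => //.
move: gE; rewrite (is_diff_val u (gd s sh)) kE mulrA -expr2 => <-.
by rewrite /g opprB addrA addrAC.
Qed.

(** Schwarz's theorem: the second difference over a parallelogram is symmetric in [u] and [v], so
    each mixed derivative takes a common value somewhere in an arbitrarily small parallelogram, and
    continuity concludes. *)
Lemma diff_symmetric_scalar (A : set V) (f : V -> R) (x u v : V) :
  open A -> smooth_on A f -> A x ->
  'd (fun z => 'd f z u) x v = 'd (fun z => 'd f z v) x u.
Proof.
move=> Ao fs Ax.
pose a z := 'd (fun z => 'd f z u) z v; pose b z := 'd (fun z => 'd f z v) z u.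
rewrite -/(a x) -/(b x).
have ac : {for x, continuous a}.
  apply/differentiable_continuous.
  exact: (smooth_on_differentiable (smooth_on_diff v (smooth_on_diff u fs))).
have bc : {for x, continuous b}.
  apply/differentiable_continuous.
  exact: (smooth_on_differentiable (smooth_on_diff u (smooth_on_diff v fs))).
apply/eqP; rewrite -subr_eq0 -normr_le0; apply/ler_addgt0Pr => e e0.
rewrite add0r; have e2 : 0 < e / 2 by rewrite divr_gt0.
have N : \forall z \near x, [/\ A z, `|a x - a z| <= e / 2 & `|b x - b z| <= e / 2].
  near=> z; split; near: z.
  - exact: open_nbhs_nbhs.
  - by move/cvgrPdist_le: ac; apply.
  - by move/cvgrPdist_le: bc; apply.
move/nbhs_normP: N => [d /= d0 N].
(* The parallelogram with sides [h *: u] and [h *: v] then lies in the ball of radius [d]; the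
   summand 1 covers vanishing [u] and [v]. *)
pose h := d / (2 * (1 + `|u| + `|v|)).
have q0 : 0 < 1 + `|u| + `|v| by rewrite ltr_wpDr// ltr_pwDl.
have h0 : 0 < h by rewrite divr_gt0// mulr_gt0.
have B s t : 0 <= s <= h -> 0 <= t <= h -> `|x - (x + s *: u + t *: v)| < d.
  move=> /andP[s0 sh] /andP[t0 th]; rewrite -addrA opprD addrA subrr sub0r normrN.
  apply: (@le_lt_trans _ _ (h * `|u| + h * `|v|)).
    apply: le_trans (ler_normD _ _) _; rewrite !normrZ (ger0_norm s0) (ger0_norm t0).
    by rewrite lerD// ler_wpM2r.
  rewrite -mulrDr /h mulrAC -mulrA mulrC.
  rewrite mulrC -[ltRHS]mulr1 ltr_pM2l// ltr_pdivrMr ?mulr_gt0// mul1r.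
  by have := normr_ge0 u; have := normr_ge0 v; lra.
have [s [t [sh th E1]]] := second_difference fs (ltW h0)
  (fun s t sh th => let: And3 Az _ _ := N _ (B s t sh th) in Az).
have B' p q : 0 <= p <= h -> 0 <= q <= h -> `|x - (x + p *: v + q *: u)| < d.
  by move=> ph qh; rewrite addrAC; exact: B.
have [s' [t' [sh' th' E2]]] := second_difference fs (ltW h0)
  (fun s t sh th => let: And3 Az _ _ := N _ (B' s t sh th) in Az).
have [_ Na _] := N _ (B s t sh th); have [_ _ Nb] := N _ (B' s' t' sh' th').
have ab : a (x + s *: u + t *: v) = b (x + s' *: v + t' *: u).
  have hn : h ^+ 2 != 0 by rewrite expf_neq0// gt_eqF.
  apply: (mulfI hn); rewrite -[LHS]E1 -[RHS]E2.
  rewrite [x + h *: v + h *: u]addrAC; congr (_ + _).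
  exact: addrAC.
rewrite ab in Na.
have -> : a x - b x = (a x - b (x + s' *: v + t' *: u)) - (b x - b (x + s' *: v + t' *: u)).
  by rewrite opprB addrA subrK.
apply: le_trans (ler_normB _ _) _; apply: le_trans (lerD Na Nb) _.
by rewrite -splitr.
Unshelve. all: by end_near. Qed.

Lemma diff_symmetric m n (A : set V) (f : V -> 'M[R]_(m, n)) (x u v : V) :
  open A -> smooth_on A f -> A x ->
  'd (fun z => 'd f z u) x v = 'd (fun z => 'd f z v) x u.
Proof.
move=> Ao fs Ax; apply/matrixP => i j.
pose g z := f z i j.
have gs : smooth_on A g by move=> k; exact: Ck_on_coord.
have gE w z : A z -> 'd g z w = 'd f z w i j.
  move=> Az; have fd := differentiableP (smooth_on_differentiable fs Az).
  exact: is_diff_val (is_diff_coord i j fd).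
have E w w' : 'd (fun z => 'd f z w) x w' i j = 'd (fun z => 'd g z w) x w'.
  have fd := differentiableP (smooth_on_differentiable (smooth_on_diff w fs) Ax).
  have gd := is_diff_coord i j fd.
  have near_g : \forall z \near x, 'd f z w i j = 'd g z w.
    by near=> z; apply/esym/gE; near: z; exact: open_nbhs_nbhs.
  exact/esym/(is_diff_val w' (near_eq_is_diff near_g gd)).
by rewrite E (E v u); exact: diff_symmetric_scalar gs Ax.
Unshelve. all: by end_near. Qed.

End SymmetricSecondDifferential.

(** * Charts of the sphere *)

Section Charts.
Context {R : realType}.

Lemma is_diff_dot {V : normedModType R} n (f df g dg : V -> 'cV[R]_n) x :
  is_diff x f df -> is_diff x g dg ->
  is_diff x (fun z => dot (f z) (g z)) (fun v => dot (f x) (dg v) + dot (df v) (g x)).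
Proof.
move=> fd gd; have ftd := is_diff_mxlin trmx fd.
apply: (is_diff_ext _ _ (is_diff_coord 0 0 (is_diff_mulmx ftd gd))) => // v.
by rewrite mxE.
Qed.

(** The columns of the Jacobian [D] are tangent to the sphere, where [H^T H] is the identity, so
    [P = H D] works. A smooth extension [h] of the inverse chart gives [(jac h *m H^T) *m P = 1],
    and [P] is square. *)
Lemma local_param_jac (A : set 'cV[R]_3) (phi : 'cV[R]_3 -> 'cV[R]_4) a :
  local_param A phi -> A a ->
  exists2 P : 'M[R]_3, P \in unitmx & jac phi a = (Hmx (phi a))^T *m P.
Proof.
move=> [Ao phis [U Uo UE] [psi psis psiK]] Aa.
have pd := differentiableP (smooth_on_differentiable phis Aa).
have S1 z : A z -> dot (phi z) (phi z) = 1.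
  move=> Az; have : (U `&` S3) (phi z) by rewrite -UE; exists z.
  by case.
have N : \forall z \near a, A z by exact: open_nbhs_nbhs.
have phi0 v : dot (phi a) ('d phi a v) = 0.
  have nd : \forall z \near a, dot (phi z) (phi z) = cst 1 z.
    by near=> z; apply: S1; near: z.
  have := is_diff_val v (near_eq_is_diff nd (is_diff_dot pd pd)).
  rewrite diff_cst /= => /esym; rewrite [X in _ + X]dotC -mulr2n => /eqP.
  by rewrite mulrn_eq0 => /eqP.
have phiAa : (phi @` A) (phi a) by exists a.
have [B [h [Bo Ba hs hE]]] := psis _ phiAa.
have hd := differentiableP (smooth_on_differentiable hs Ba).
have hK : \forall z \near a, h (phi z) = z.
  have pc : {for a, continuous phi} by exact/differentiable_continuous/ex_diff.
  have NB : \forall z \near a, B (phi z).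
    by apply: (@near_fun _ _ phi a B pc); exact: open_nbhs_nbhs.
  near=> z; rewrite hE ?psiK//; first by near: z.
  by split; [near: z|exists z => //; near: z].
have hphi v : 'd h (phi a) ('d phi a v) = v.
  have := is_diff_val v (near_eq_is_diff hK (is_diff_comp pd hd)).
  by rewrite (is_diff_val v (is_diff_id a)).
pose D := jac phi a; have DE v : D *m v = 'd phi a v by exact: jac_mulmx.
have xD : (phi a)^T *m D = 0.
  apply/matrixP => i j; have := phi0 (delta_mx j 0).
  by rewrite -DE /dot mulmxA -colE (ord1 i) !mxE.
have KD : jac h (phi a) *m D = 1%:M.
  apply: mulmx_fix_eq1 => v; rewrite -mulmxA DE -[RHS]hphi; exact: jac_mulmx.
have DH : D = (Hmx (phi a))^T *m (Hmx (phi a) *m D).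
  by rewrite mulmxA Hmx_tr_mul S1// mulmxBl mul1mx -mulmxA xD mulmx0 subr0.
exists (Hmx (phi a) *m D) => //.
have : jac h (phi a) *m (Hmx (phi a))^T *m (Hmx (phi a) *m D) = 1%:M.
  by rewrite -mulmxA -DH KD.
by case/mulmx1_unit.
Unshelve. all: by end_near. Qed.

(* alpha is locally h o theta for a smooth extension h of the inverse chart. *)
Lemma local_param_lift (A : set 'cV[R]_3) (phi : 'cV[R]_3 -> 'cV[R]_4)
    (J I : set R) (theta : R -> 'cV[R]_4) (alpha : R -> 'cV[R]_3) :
  local_param A phi -> open J -> open I -> J `<=` I -> smooth_on I theta ->
  (forall t, J t -> A (alpha t) /\ theta t = phi (alpha t)) ->
  forall t, J t -> is_diff t alpha (fun v => v *: alpha^`()%classic t) /\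
    differentiable alpha^`()%classic t.
Proof.
move=> [Ao phis _ [psi psis psiK]] Jo Io JI ths al t Jt.
have phiA s : J s -> (phi @` A) (theta s).
  by move=> /al[As ->]; exists (alpha s).
have [B [h [Bo Bt hs hE]]] := psis _ (phiA t Jt).
have thd s : J s -> is_diff s theta (fun v => v *: theta^`()%classic s).
  by move=> /JI; exact: smooth_curve_is_diff.
have thc s : J s -> {for s, continuous theta}.
  by move=> /thd[/differentiable_continuous].
have JB s : J s -> B (theta s) ->
    is_diff s alpha (fun v => v *: 'd h (theta s) (theta^`()%classic s)).
  move=> Js Bs.
  have hd := differentiableP (smooth_on_differentiable hs Bs).
  have NB : \forall r \near s, B (theta r).
    by apply: (@near_fun _ _ theta s B (thc s Js)); exact: open_nbhs_nbhs.
  have NJ : \forall r \near s, J r by exact: open_nbhs_nbhs.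
  have hal : \forall r \near s, h (theta r) = alpha r.
    near=> r; have Jr : J r by near: r.
    rewrite hE; last by split; [near: r|exact: phiA].
    by have [Ar ->] := al r Jr; rewrite psiK.
  apply: (near_eq_is_diff hal).
  apply: (is_diff_ext _ _ (is_diff_comp (thd s Js) hd)) => // v.
  exact: linearZ.
split; first by rewrite (is_diff_derive1 (JB t Jt Bt)) scale1r; exact: JB.
have D := is_diff_diff hs Bt (thd t Jt)
  (smooth_curve_is_diff (smooth_derive1 Io ths) (JI t Jt)).
have NB : \forall r \near t, B (theta r).
  by apply: (@near_fun _ _ theta t B (thc t Jt)); exact: open_nbhs_nbhs.
have NJ : \forall r \near t, J r by exact: open_nbhs_nbhs.
have E : \forall r \near t, 'd h (theta r) (theta^`()%classic r) = alpha^`()%classic r.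
  near=> r; have Jr : J r by near: r.
  have Br : B (theta r) by near: r.
  by rewrite (is_diff_derive1 (JB r Jr Br)) scale1r.
by have [] := near_eq_is_diff E D.
Unshelve. all: by end_near. Qed.

(** For unit [x0], inverse stereographic projection from [- x0], with the rows of [Hmx x0] as
    orthonormal basis of the orthogonal complement of [x0]; the origin goes to [x0] and only [- x0]
    is missed. *)
Definition stereo (x0 : 'cV[R]_4) (a : 'cV[R]_3) : 'cV[R]_4 :=
  (1 + dot a a)^-1 *: ((1 - dot a a) *: x0 + 2 *: ((Hmx x0)^T *m a)).

Definition stereo_inv (x0 x : 'cV[R]_4) : 'cV[R]_3 :=
  (1 + dot x0 x)^-1 *: (Hmx x0 *m x).

Lemma stereo_den n (a : 'cV[R]_n) : 1 + dot a a != 0.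
Proof. by rewrite gt_eqF// ltr_pwDl// dot_ge0. Qed.

Section Stereographic.
Variables (x0 : 'cV[R]_4) (x01 : dot x0 x0 = 1).

Lemma dot_stereo a : dot x0 (stereo x0 a) = (1 + dot a a)^-1 * (1 - dot a a).
Proof.
rewrite dotZr dotDr !dotZr x01 dot_mulmxr trmxK Hmx_self.
by rewrite [dot 0 a]dotC /dot mulmx0 [X in 2 * X]mxE mulr0 addr0 mulr1.
Qed.

Lemma stereoK a : stereo_inv x0 (stereo x0 a) = a.
Proof.
rewrite /stereo_inv dot_stereo /stereo -scalemxAr mulmxDr -!scalemxAr Hmx_self.
rewrite mulmxA Hmx_mul_tr x01 mul1mx scaler0 add0r !scalerA.
rewrite (_ : _ * _ = 1) ?scale1r//; field.
have n0 := stereo_den a; rewrite n0 /= (_ : _ + _ = 2) ?pnatr_eq0//; ring.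
Qed.

Lemma stereo_S3 a : S3 (stereo x0 a).
Proof.
rewrite /S3 /=; have n0 := stereo_den a.
rewrite dotZr dotC dotZr dotDr !dotZr ![dot (_ + _) _]dotC !dotDr !dotZr x01.
have h1 : dot x0 ((Hmx x0)^T *m a) = 0.
  by rewrite dot_mulmxr trmxK Hmx_self [LHS]dotC /dot mulmx0 mxE.
rewrite [dot (_ *m _) x0]dotC h1 [dot (_ *m _) (_ *m _)]dot_mulmxr trmxK mulmxA.
by rewrite Hmx_mul_tr x01 mul1mx; field.
Qed.

Lemma stereo_invK x : S3 x -> 1 + dot x0 x != 0 -> stereo x0 (stereo_inv x0 x) = x.
Proof.
rewrite /S3 /= => x1 n0; set c := dot x0 x in n0 *.
have HH : (Hmx x0)^T *m (Hmx x0 *m x) = x - c *: x0.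
  rewrite mulmxA Hmx_tr_mul x01 mulmxBl mul1mx -mulmxA; congr (_ - _).
  by rewrite [x0^T *m x]mx11_scalar mul_mx_scalar.
have q : dot (stereo_inv x0 x) (stereo_inv x0 x) = (1 - c) / (1 + c).
  rewrite /stereo_inv -/c dotZr dotC dotZr dot_mulmxr HH dotC dotDr x1.
  rewrite -scaleN1r scalerA mulN1r dotZr [dot x x0]dotC -/c.
  by field.
have n2 : 1 + (1 - c) / (1 + c) = 2 / (1 + c) by field.
rewrite /stereo q n2 /stereo_inv -/c -scalemxAr HH; clearbody c.
by apply/matrixP => i j; rewrite !mxE; field.
Qed.

(** The inverse is a rational map whose only denominator is [1 + dot x0 x], so it is its own smooth
    extension to the open set [O]. *)
Lemma stereo_local_param : local_param setT (stereo x0).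
Proof.
have dots n : smooth_on setT (fun a : 'cV[R]_n => dot a a).
  move=> k; apply: (Ck_on_coord 0 0 openT); apply: (Ck_on_mulmx openT).
    by apply: (Ck_on_mxlin trmx openT); exact: Ck_on_id.
  exact: Ck_on_id.
pose O := [set x : 'cV[R]_4 | 1 + dot x0 x != 0].
have dks A : open A -> smooth_on A (fun x : 'cV[R]_4 => 1 + dot x0 x).
  move=> Ao k; apply: (Ck_onD Ao); first exact: Ck_on_cst.
  apply: (Ck_on_coord 0 0 Ao); apply: (Ck_on_mulmx Ao); first exact: Ck_on_cst.
  exact: Ck_on_id.
have Oo : open O.
  rewrite (_ : O = (fun x : 'cV[R]_4 => 1 + dot x0 x) @^-1` [set x | x != 0])//.
  apply: open_comp; last exact: open_neq.
  by move=> x _; exact: (dks _ openT 0%N).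
split; [exact: openT| | |].
- move=> k; apply: (Ck_onZf openT).
    apply: (Ck_onV openT) => [a _|]; first exact: stereo_den.
    by apply: (Ck_onD openT); [exact: Ck_on_cst|exact: dots].
  apply: (Ck_onD openT); apply: (Ck_onZf openT); try exact: Ck_on_cst.
    apply: (Ck_onD openT); first exact: Ck_on_cst.
    have := Ck_onM openT (Ck_on_cst k setT (-1 : R)) (dots 3 k).
    by under eq_fun do rewrite mulN1r.
  by apply: (Ck_on_mulmx openT); [exact: Ck_on_cst|exact: Ck_on_id].
- exists O => //; apply/seteqP; split => x /=.
    move=> [a _ <-]; split; last exact: stereo_S3.
    have n0 := stereo_den a; rewrite /O /= dot_stereo.
    rewrite (_ : 1 + _ = 2 / (1 + dot a a)); last by field.
    by rewrite mulf_neq0 ?invr_neq0 ?pnatr_eq0.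
  by move=> [Ox Sx]; exists (stereo_inv x0 x) => //; exact: stereo_invK.
- exists (stereo_inv x0) => [x [a _ <-]|a _]; last exact: stereoK.
  exists O, (stereo_inv x0); split => //.
    have n0 := stereo_den a; rewrite /O /= dot_stereo.
    rewrite (_ : 1 + _ = 2 / (1 + dot a a)); last by field.
    by rewrite mulf_neq0 ?invr_neq0 ?pnatr_eq0.
  move=> k; apply: (Ck_onZf Oo).
    by apply: (Ck_onV Oo) => //; exact: dks.
  by apply: (Ck_on_mulmx Oo); [exact: Ck_on_cst|exact: Ck_on_id].
Qed.

End Stereographic.
End Charts.

(** * The Lagrangian in a chart *)

Section ChartLagrangian.
Context {R : realType} {l : nat}.
Variable B : rigid_body R l.
Hypothesis inertia_sym : (inertia B)^T = inertia B.
Hypothesis potential_smooth : smooth_on setT (potential B).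
Variables (A : set 'cV[R]_3) (phi : 'cV[R]_3 -> 'cV[R]_4).
Hypotheses (Ao : open A) (phis : smooth_on A phi).

Let phid a : A a -> is_diff a phi ('d phi a).
Proof. by move=> Aa; exact/differentiableP/(smooth_on_differentiable phis). Qed.

Let usub_diff m n (z : 'cV[R]_(m + n)) : is_diff z usubmx usubmx.
Proof. exact: (is_diff_mxlin usubmx (is_diff_id z)). Qed.

Let dsub_diff m n (z : 'cV[R]_(m + n)) : is_diff z dsubmx dsubmx.
Proof. exact: (is_diff_mxlin dsubmx (is_diff_id z)). Qed.

Lemma chart_map_is_diff z : A (dsubmx z) -> is_diff z (chart_map phi)
  (fun v => col_mx (usubmx v) ('d phi (dsubmx z) (dsubmx v))).
Proof.
move=> Az; apply: is_diff_col_mx; first exact: usub_diff.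
exact: is_diff_comp (dsub_diff z) (phid Az).
Qed.

Lemma jac_chart_map z v : A (dsubmx z) -> jac (chart_map phi) z *m v =
  col_mx (usubmx v) ('d phi (dsubmx z) (dsubmx v)).
Proof.
by move=> Az; rewrite jac_mulmx; exact: is_diff_val (chart_map_is_diff Az).
Qed.

(** Half the angular velocity in the body frame, which is 2 H theta1. *)
Definition body_velocity (z w : 'cV[R]_(3 + 3)) : 'cV[R]_3 :=
  Hmx (phi (dsubmx z)) *m 'd phi (dsubmx z) (dsubmx w).

Lemma chart_lagrangianE z w : A (dsubmx z) -> chart_lagrangian B phi z w =
  2^-1 * mass B * dot (usubmx w) (usubmx w) +
  2 * dot (body_velocity z w) (inertia B *m body_velocity z w) -
  potential B (chart_map phi z).
Proof.
move=> Az; rewrite /chart_lagrangian /lagrangian /kinetic jac_chart_map//.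
by rewrite /pos_of /eul_of /chart_map !col_mxKu !col_mxKd.
Qed.

Lemma is_diff_quadratic {V : normedModType R} (f df : V -> 'cV[R]_3) x :
  is_diff x f df -> is_diff x (fun z => 2 * dot (f z) (inertia B *m f z))
    (fun v => 4 * dot (df v) (inertia B *m f x)).
Proof.
move=> fd; have D := is_diff_dot fd (is_diff_mxlin (mulmx (inertia B)) fd).
apply: (is_diff_ext _ _ (is_diffZ 2 D)) => // v.
rewrite fctE /= dot_mulmxr inertia_sym [dot (_ *m _) _]dotC -mulr2n.
by rewrite -[LHS]/(2 * (_ *+ 2)); ring.
Qed.

Lemma chart_lagrangian_diff1 z w : A (dsubmx z) ->
  is_diff w (chart_lagrangian B phi z) (fun e =>
    mass B * dot (usubmx w) (usubmx e) +
    4 * dot (body_velocity z e) (inertia B *m body_velocity z w)).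
Proof.
move=> Az.
have D1 := is_diff_dot (usub_diff w) (usub_diff w).
have vd : is_diff w (body_velocity z) (body_velocity z).
  apply: (is_diff_mxlin (mulmx _)).
  exact: (is_diff_mxlin ('d phi (dsubmx z)) (dsub_diff w)).
have D := is_diffD (is_diffD (is_diffZ (2^-1 * mass B) D1) (is_diff_quadratic vd))
  (is_diff_cst (- potential B (chart_map phi z)) w).
apply: (is_diff_ext _ _ D) => [v|e]; first by rewrite chart_lagrangianE.
rewrite !fctE addr0; congr (_ + _); rewrite [dot (usubmx e) _]dotC.
by rewrite -[LHS]/(2^-1 * mass B * _) -mulr2n; field.
Qed.

Lemma chart_lagrangian_diff2 z w : A (dsubmx z) ->
  is_diff z (fun x => chart_lagrangian B phi x w) (fun e =>
    4 * dot (Hmx ('d phi (dsubmx z) (dsubmx e)) *m 'd phi (dsubmx z) (dsubmx w) +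
        Hmx (phi (dsubmx z)) *m
          'd (fun a => 'd phi a (dsubmx w)) (dsubmx z) (dsubmx e))
      (inertia B *m body_velocity z w) -
    'd (potential B) (chart_map phi z)
      (col_mx (usubmx e) ('d phi (dsubmx z) (dsubmx e)))).
Proof.
move=> Az.
have dc : is_diff z (fun x : 'cV[R]_(3 + 3) => 'd phi (dsubmx x) (dsubmx w))
    (fun e => 'd (fun a => 'd phi a (dsubmx w)) (dsubmx z) (dsubmx e)).
  have pd := differentiableP (smooth_on_differentiable (smooth_on_diff (dsubmx w) phis) Az).
  exact: is_diff_comp (dsub_diff z) pd.
have Hd : is_diff z (fun x : 'cV[R]_(3 + 3) => Hmx (phi (dsubmx x)))
    (fun e => Hmx ('d phi (dsubmx z) (dsubmx e))).
  pose HL : {linear 'cV[R]_4 -> 'M[R]_(3, 4)} := @Hmx R.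
  exact: (is_diff_mxlin HL (is_diff_comp (dsub_diff z) (phid Az))).
have vd := is_diff_quadratic (is_diff_mulmx Hd dc).
have Ud := differentiableP
  (smooth_on_differentiable (x := chart_map phi z) potential_smooth Logic.I).
have D := is_diffB (is_diffD (is_diff_cst (2^-1 * mass B * dot (usubmx w) (usubmx w)) z) vd)
  (is_diff_comp (chart_map_is_diff Az) Ud).
have N : \forall x \near z, A (dsubmx x).
  apply: (@near_fun _ _ dsubmx z A).
    by have [/differentiable_continuous] := dsub_diff z.
  exact: open_nbhs_nbhs.
have E : \forall x \near z, 2^-1 * mass B * dot (usubmx w) (usubmx w) +
  2 * dot (body_velocity x w) (inertia B *m body_velocity x w) -
  potential B (chart_map phi x) = chart_lagrangian B phi x w.
  by near=> x; rewrite chart_lagrangianE//; near: x.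
have D' := near_eq_is_diff E D.
apply: (is_diff_ext _ _ D') => // e; rewrite !fctE add0r; congr (4 * dot _ _ - _).
exact: addrC.
Unshelve. all: by end_near. Qed.

End ChartLagrangian.

(** * The Euler-Lagrange expression along a lifted curve *)

Section EulerLagrange.
Context {R : realType} {l : nat}.
Variable B : rigid_body R l.
Hypothesis inertia_sym : (inertia B)^T = inertia B.
Hypothesis potential_smooth : smooth_on setT (potential B).
Hypothesis constraint_smooth : smooth_on setT (constraint B).
Variables (I J : set R) (y : R -> 'cV[R]_(3 + 4)).
Hypotheses (Io : open I) (Jo : open J) (JI : J `<=` I) (ys : smooth_on I y).
Variables (A : set 'cV[R]_3) (phi : 'cV[R]_3 -> 'cV[R]_4) (alpha : R -> 'cV[R]_3).
Hypothesis phi_chart : local_param A phi.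
Hypothesis alphaE : forall t, J t -> A (alpha t) /\ eul_of (y t) = phi (alpha t).

Let q t := col_mx (pos_of (y t)) (alpha t).
Let y1 := y^`()%classic.
Let y2 := y^`()^`()%classic.

Let Ao : open A. Proof. by case: phi_chart. Qed.
Let phis : smooth_on A phi. Proof. by case: phi_chart. Qed.

Let yd t : J t -> is_diff t y (fun v => v *: y1 t).
Proof. by move=> /JI; exact: smooth_curve_is_diff. Qed.

Let y1d t : J t -> is_diff t y1 (fun v => v *: y2 t).
Proof. by move=> /JI; exact: smooth_curve_is_diff (smooth_derive1 Io ys). Qed.

Let euld t : J t -> is_diff t (fun s => eul_of (y s)) (fun v => eul_of (v *: y1 t)).
Proof. by move=> Jt; exact: (is_diff_mxlin dsubmx (yd Jt)). Qed.

Let alphad t : J t -> is_diff t alpha (fun v => v *: alpha^`()%classic t) /\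
  differentiable alpha^`()%classic t.
Proof.
have ths : smooth_on I (fun s => eul_of (y s)).
  by move=> k; exact: (Ck_on_mxlin dsubmx Io (ys k)).
exact: local_param_lift phi_chart Jo Io JI ths alphaE t.
Qed.

Let near_J t : J t -> \forall s \near t, J s.
Proof. by move=> Jt; exact: open_nbhs_nbhs. Qed.

Lemma eul_velocity t : J t ->
  eul_of (y1 t) = 'd phi (alpha t) (alpha^`()%classic t).
Proof.
move=> Jt; have [At _] := alphaE Jt.
have pd := differentiableP (smooth_on_differentiable phis At).
have D := is_diff_comp (alphad Jt).1 pd.
have E : \forall s \near t, eul_of (y s) = (phi \o alpha) s.
  by near=> s; have [] := alphaE (near (near_J Jt) s _).
have := near_eq_derive1 E; rewrite (is_diff_derive1 (euld Jt)) scale1r => ->.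
by rewrite (is_diff_derive1 D) /= scale1r.
Unshelve. all: by end_near. Qed.

Lemma lift_velocity t : J t ->
  q^`()%classic t = col_mx (pos_of (y1 t)) (alpha^`()%classic t).
Proof.
move=> Jt.
have D := is_diff_col_mx (is_diff_mxlin usubmx (yd Jt)) (alphad Jt).1.
by rewrite (is_diff_derive1 D) !scale1r.
Qed.

Lemma chart_map_lift t : J t -> chart_map phi (q t) = y t.
Proof.
move=> Jt; have [_ E] := alphaE Jt.
by rewrite /chart_map /q col_mxKu col_mxKd -E vsubmxK.
Qed.

Let AJ t : J t -> A (dsubmx (q t)).
Proof. by move=> Jt; rewrite col_mxKd; have [] := alphaE Jt. Qed.

Let velE t : J t ->
  body_velocity phi (q t) (q^`()%classic t) = Hmx (eul_of (y t)) *m eul_of (y1 t).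
Proof.
move=> Jt; have [_ E] := alphaE Jt.
by rewrite /body_velocity (lift_velocity Jt) !col_mxKd -(eul_velocity Jt) -E.
Qed.

Lemma momentumE t (e : 'cV[R]_(3 + 3)) : J t ->
  'd (chart_lagrangian B phi (q t)) (q^`()%classic t) e =
    mass B * dot (pos_of (y1 t)) (usubmx e) +
    4 * dot (Hmx (eul_of (y t)) *m 'd phi (alpha t) (dsubmx e))
      (inertia B *m (Hmx (eul_of (y t)) *m eul_of (y1 t))).
Proof.
move=> Jt.
have D := chart_lagrangian_diff1 inertia_sym phis (q^`()%classic t) (AJ Jt).
apply: etrans (is_diff_val e D) _; rewrite (velE Jt) (lift_velocity Jt) col_mxKu.
by rewrite /body_velocity col_mxKd; have [_ <-] := alphaE Jt.
Qed.

Let Hd t : J t -> is_diff t (fun s => Hmx (eul_of (y s)))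
  (fun v => Hmx (eul_of (v *: y1 t))).
Proof.
move=> Jt; pose HL : {linear 'cV[R]_4 -> 'M[R]_(3, 4)} := @Hmx R.
exact: (is_diff_mxlin HL (euld Jt)).
Qed.

Let alpha_pos t (e : 'cV[R]_(3 + 3)) : J t ->
  is_diff t (fun s => 'd phi (alpha s) (dsubmx e))
    (fun v => 'd (fun a => 'd phi a (dsubmx e)) (alpha t)
       (v *: alpha^`()%classic t)) .
Proof.
move=> Jt; have [At _] := alphaE Jt.
have D := is_diff_diff phis At (alphad Jt).1 (is_diff_cst (dsubmx e) t).
apply: (is_diff_ext _ _ D) => // v.
by rewrite -[RHS]add0r; congr (_ + _); exact: linear0.
Qed.

(** The momentum is tested against a fixed vector [e], so that only a scalar function of time has to
    be differentiated. *)
Lemma momentum_derive t (e : 'cV[R]_(3 + 3)) : J t ->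
  is_diff t (fun s => 'd (chart_lagrangian B phi (q s)) (q^`()%classic s) e)
    (fun v => mass B * dot (pos_of (v *: y2 t)) (usubmx e) +
      4 * (dot (Hmx (eul_of (y t)) *m 'd phi (alpha t) (dsubmx e))
             (inertia B *m (Hmx (eul_of (y t)) *m eul_of (v *: y2 t) +
                            Hmx (eul_of (v *: y1 t)) *m eul_of (y1 t))) +
           dot (Hmx (eul_of (y t)) *m
                  'd (fun a => 'd phi a (dsubmx e)) (alpha t)
                     (v *: alpha^`()%classic t) +
                Hmx (eul_of (v *: y1 t)) *m 'd phi (alpha t) (dsubmx e))
             (inertia B *m (Hmx (eul_of (y t)) *m eul_of (y1 t))))).
Proof.
move=> Jt.
have D1 := is_diff_dot (is_diff_mxlin usubmx (y1d Jt)) (is_diff_cst (usubmx e) t).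
have D2 := is_diff_mulmx (Hd Jt) (alpha_pos e Jt).
have D3 := is_diff_mxlin (mulmx (inertia B))
  (is_diff_mulmx (Hd Jt) (is_diff_mxlin dsubmx (y1d Jt))).
have D := is_diffD (is_diffZ (mass B) D1) (is_diffZ 4 (is_diff_dot D2 D3)).
have E : \forall s \near t,
   mass B * dot (pos_of (y1 s)) (usubmx e) +
    4 * dot (Hmx (eul_of (y s)) *m 'd phi (alpha s) (dsubmx e))
      (inertia B *m (Hmx (eul_of (y s)) *m eul_of (y1 s))) =
   'd (chart_lagrangian B phi (q s)) (q^`()%classic s) e.
  by near=> s; apply/esym/momentumE; near: s; exact: near_J.
apply: (is_diff_ext _ _ (near_eq_is_diff E D)) => // v.
rewrite fctE; congr (_ * _ + _ * _).
by rewrite {1}/dot mulmx0 mxE add0r.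
Unshelve. all: by end_near. Qed.

(** The mixed second differential of the chart is stated with its directions in the order of
    [momentum_derive], ready to cancel. *)
Lemma chart_forceE t (e : 'cV[R]_(3 + 3)) : J t ->
  let w := 'd phi (alpha t) (dsubmx e) in
  'd (fun z => chart_lagrangian B phi z (q^`()%classic t)) (q t) e =
    4 * dot (Hmx w *m eul_of (y1 t) + Hmx (eul_of (y t)) *m
          'd (fun a => 'd phi a (dsubmx e)) (alpha t) (alpha^`()%classic t))
      (inertia B *m (Hmx (eul_of (y t)) *m eul_of (y1 t))) -
    'd (potential B) (y t) (col_mx (usubmx e) w).
Proof.
move=> Jt w; have [At Et] := alphaE Jt.
have D := chart_lagrangian_diff2 inertia_sym potential_smooth Ao phis
  (q^`()%classic t) (AJ Jt).
apply: etrans (is_diff_val e D) _.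
rewrite (velE Jt) (chart_map_lift Jt) (lift_velocity Jt).
have -> : dsubmx (q t) = alpha t by rewrite col_mxKd.
rewrite col_mxKd.
pose F (a : 'cV[R]_4) b (c : 'cV[R]_4) :=
  4 * dot (Hmx w *m a + Hmx b *m c)
    (inertia B *m (Hmx (eul_of (y t)) *m eul_of (y1 t))) -
  'd (potential B) (y t) (col_mx (usubmx e) w).
exact: (f_equal3 F (esym (eul_velocity Jt)) (esym Et) (diff_symmetric _ _ Ao phis At)).
Qed.

(** The factor 8 of [Ktilde] arises here: 4 from the derivative of the momentum and 4 from the
    derivative in position, whose sign is reversed by antisymmetry. The same antisymmetry removes
    [Hmx x1 *m x1]. *)
Let euler_lagrange_algebra (a dU : R) (x x1 x2 w d : 'cV[R]_4) (K : 'M[R]_3) :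
  a + 4 * (dot (Hmx x *m w) (K *m (Hmx x *m x2 + Hmx x1 *m x1)) +
           dot (Hmx x *m d + Hmx x1 *m w) (K *m (Hmx x *m x1))) -
  (4 * dot (Hmx w *m x1 + Hmx x *m d) (K *m (Hmx x *m x1)) - dU) =
  a + 4 * dot (Hmx x *m w) (K *m (Hmx x *m x2)) +
  8 * dot (Hmx x1 *m w) (K *m (Hmx x *m x1)) + dU.
Proof.
rewrite Hmx_self addr0 [Hmx w *m _]Hmx_mulC; move: (K *m (Hmx x *m x1)) => v.
rewrite ![dot (_ + _) v]dotC !dotDr -[- (Hmx x1 *m w)]scaleN1r dotZr ![dot v _]dotC.
by ring.
Qed.

(* The second derivatives of the chart cancel by symmetry; the two remaining
   quadratic terms are equal because H(a) b = - H(b) a. *)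
Lemma euler_lagrange_component t i : J t ->
  let e : 'cV[R]_(3 + 3) := delta_mx i 0 in
  let w := 'd phi (alpha t) (dsubmx e) in
  euler_lagrange B phi q t i 0 =
    mass B * dot (pos_of (y2 t)) (usubmx e) +
    4 * dot (Hmx (eul_of (y t)) *m w) (inertia B *m (Hmx (eul_of (y t)) *m eul_of (y2 t))) +
    8 * dot (Hmx (eul_of (y1 t)) *m w) (inertia B *m (Hmx (eul_of (y t)) *m eul_of (y1 t))) +
    'd (potential B) (y t) (col_mx (usubmx e) w).
Proof.
move=> Jt e w; have [At Et] := alphaE Jt.
pose p s := grad (chart_lagrangian B phi (q s)) (q^`()%classic s).
have pE : (p^`()%classic t) i 0 =
    mass B * dot (pos_of (y2 t)) (usubmx e) +
      4 * (dot (Hmx (eul_of (y t)) *m w)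
             (inertia B *m (Hmx (eul_of (y t)) *m eul_of (y2 t) +
                            Hmx (eul_of (y1 t)) *m eul_of (y1 t))) +
           dot (Hmx (eul_of (y t)) *m
                  'd (fun a => 'd phi a (dsubmx e)) (alpha t) (alpha^`()%classic t) +
                Hmx (eul_of (y1 t)) *m w)
             (inertia B *m (Hmx (eul_of (y t)) *m eul_of (y1 t)))).
  pose dp (j : 'I_(3 + 3)) v := 'd (fun s => 'd (chart_lagrangian B phi (q s))
    (q^`()%classic s) (delta_mx j 0)) t v.
  have pd : is_diff t p (fun v => \col_j dp j v).
    apply: is_diff_mx => j k.
    have D := differentiableP (@ex_diff _ _ _ _ _ _ _ (momentum_derive (delta_mx j 0) Jt)).
    by apply: (is_diff_ext _ _ D) => v; rewrite mxE.
  rewrite (is_diff_derive1 pd) mxE.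
  by apply: etrans (is_diff_val (1 : R) (momentum_derive e Jt)) _; rewrite !scale1r.
have fE := chart_forceE e Jt.
have EL : euler_lagrange B phi q t i 0 = (p^`()%classic t) i 0 -
    'd (fun z => chart_lagrangian B phi z (q^`()%classic t)) (q t) e.
  by rewrite mxE [X in _ + X]mxE [X in - X]mxE.
apply: (etrans EL); apply: (etrans (congr2 (fun a b => a - b) pE fE)).
exact: euler_lagrange_algebra.
Qed.

Let p t := prolong y t.

(** On test vectors [w = H^T f] the factor [Hmx x1 *m H^T] moves to the other side as
    [H *m (Hmx x1)^T], which is the shape of [Ktilde]. *)
Let body_equation_dot (x x1 x2 : 'cV[R]_4) (r2 : 'cV[R]_3) (gU : 'cV[R]_(3 + 4))
    (e f : 'cV[R]_3) :
  dot x x = 1 ->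
  mass B * dot r2 e +
  4 * dot (Hmx x *m ((Hmx x)^T *m f)) (inertia B *m (Hmx x *m x2)) +
  8 * dot (Hmx x1 *m ((Hmx x)^T *m f)) (inertia B *m (Hmx x *m x1)) +
  dot gU (col_mx e ((Hmx x)^T *m f)) =
  dot (col_mx (mass B *: r2) (4 *: (inertia B *m (Hmx x *m x2))) +
       8 *: col_mx 0 (Hmx x *m (Hmx x1)^T *m inertia B *m Hmx x *m x1) +
       block_mx 1%:M 0 0 (Hmx x) *m gU) (col_mx e f).
Proof.
move=> x1E; rewrite !dotDl dotZl !dot_col_mx !dotZl dot0l add0r (dot_mulmxl (block_mx _ _ _ _)).
rewrite tr_block_mx !trmx0 trmx1 mul_block_col mul1mx !mul0mx addr0 add0r.
rewrite mulmxA Hmx_mul_tr x1E mul1mx [dot f _]dotC; congr (_ + 8 * _ + _).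
by rewrite (dot_mulmxl (Hmx x1)) (dot_mulmxl (Hmx x)^T) dotC trmxK !mulmxA.
Qed.

(** A single [S] factors the inertial, force and constraint terms at once, so the multiplier lambda
    is the same in every chart and in the body equation. *)
Lemma euler_lagrange_chart t : J t -> dot (eul_of (y t)) (eul_of (y t)) = 1 ->
  exists2 S : 'M[R]_(3 + 3), S \in unitmx &
  [/\ euler_lagrange B phi q t =
        S *m (inertia_mx B *m (bigH (y t) *m y2 t) + 8 *: Ktilde B (p t) +
              bigH (y t) *m grad (potential B) (y t)),
     col_mx (force B (p t))
       (2 *: ((jac phi (alpha t))^T *m (Hmx (eul_of (y t)))^T *m torque B (p t)))
       = S *m ext_force B (p t) &
     (jac (constraint B \o chart_map phi) (q t))^T =
       S *m (bigH (y t) *m (jac (constraint B) (y t))^T)].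
Proof.
move=> Jt th1; have [At Et] := alphaE Jt.
have [P Pu PE] := local_param_jac phi_chart At; rewrite -Et in PE.
(* The Jacobian of the chart map is [(bigH (y t))^T *m T]; hence the witness [T^T]. *)
pose T : 'M[R]_(3 + 3) := block_mx 1%:M 0 0 P.
have TE e : T *m e = col_mx (usubmx e) (P *m dsubmx e).
  by rewrite -{1}(vsubmxK e) mul_block_col mul1mx !mul0mx addr0 add0r.
have jE v : 'd phi (alpha t) v = (Hmx (eul_of (y t)))^T *m (P *m v).
  by rewrite mulmxA -PE; exact/esym/jac_mulmx.
have hE : inertia_mx B *m (bigH (y t) *m y2 t) =
    col_mx (mass B *: pos_of (y2 t))
      (4 *: (inertia B *m (Hmx (eul_of (y t)) *m eul_of (y2 t)))).
  have y2E : y2 t = col_mx (pos_of (y2 t)) (eul_of (y2 t)) by rewrite vsubmxK.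
  rewrite {1}y2E /bigH mul_block_col mul1mx !mul0mx addr0 add0r.
  by rewrite /inertia_mx mul_block_col !mul0mx addr0 add0r mul_scalar_mx -scalemxAl.
exists T^T.
  by rewrite unitmx_tr unitmxE det_lblock det1 mul1r -unitmxE.
split.
- apply/matrixP => i j; rewrite (ord1 j) {j}.
  pose e : 'cV[R]_(3 + 3) := delta_mx i 0.
  rewrite -[RHS]dot_delta -dot_mulmxr TE -/e.
  pose F w := mass B * dot (pos_of (y2 t)) (usubmx e) +
    4 * dot (Hmx (eul_of (y t)) *m w) (inertia B *m (Hmx (eul_of (y t)) *m eul_of (y2 t))) +
    8 * dot (Hmx (eul_of (y1 t)) *m w) (inertia B *m (Hmx (eul_of (y t)) *m eul_of (y1 t))).
  pose F' w := F w + 'd (potential B) (y t) (col_mx (usubmx e) w).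
  apply: (etrans (euler_lagrange_component i Jt)).
  apply: (etrans (congr1 F' (jE (dsubmx e)))).
  apply: (etrans (congr1 (fun a => _ + a) (esym (grad_dot (potential B) (y t) _)))).
  apply: (etrans (body_equation_dot _ _ _ _ _ _ th1)).
  exact: (congr1 (fun u => dot (u + 8 *: Ktilde B (p t) + _) _) (esym hE)).
- rewrite tr_block_mx trmx1 !trmx0 /ext_force mul_block_col mul1mx !mul0mx addr0 add0r.
  by rewrite PE trmx_mul trmxK -scalemxAr -!mulmxA (mulmxA (Hmx _)) Hmx_mul_tr th1 mul1mx.
apply: trmx_inj; rewrite trmxK !trmx_mul !trmxK.
apply/matrixP => i j.
have Aq : A (dsubmx (q t)) by exact: AJ.
have Gd := differentiableP
  (smooth_on_differentiable (x := chart_map phi (q t)) constraint_smooth Logic.I).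
pose e : 'cV[R]_(3 + 3) := delta_mx j 0.
have E : jac (constraint B \o chart_map phi) (q t) *m e =
    jac (constraint B) (y t) *m (bigH (y t))^T *m T *m e.
  apply: (etrans (jac_mulmx (constraint B \o chart_map phi) (q t) e)).
  apply: (etrans (is_diff_val _ (is_diff_comp (chart_map_is_diff phis Aq) Gd))).
  have -> : dsubmx (q t) = alpha t by rewrite col_mxKd.
  rewrite chart_map_lift//=; rewrite -!mulmxA TE.
  apply: etrans (esym (jac_mulmx _ _ _)) _; congr (_ *m _).
  rewrite /bigH tr_block_mx trmx1 !trmx0 mul_block_col mul1mx !mul0mx addr0 add0r.
  by congr col_mx; exact: jE.
have := congr1 (fun v : 'cV[R]_l => v i 0) E.
by rewrite /e -!colE !mxE.
Qed.

End EulerLagrange.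

(** * Dynamics on the state space *)

Section StateSpace.
Context {R : realType} {l : nat}.
Variable B : rigid_body R l.
Hypothesis data_ok : well_posed_data B.
Hypothesis indep : independent_constraints B.

Let mass_gt0 : 0 < mass B. Proof. by case: data_ok. Qed.
Let inertia_sym : (inertia B)^T = inertia B. Proof. by case: data_ok => _ []. Qed.
Let inertia_pos (v : 'cV[R]_3) : v != 0 -> 0 < dot v (inertia B *m v).
Proof. by case: data_ok => _ [_ +] _; exact. Qed.
Let potential_smooth : smooth_on setT (potential B).
Proof. by case: data_ok => _ _ []. Qed.
Let constraint_smooth : smooth_on setT (constraint B).
Proof. by case: data_ok => _ _ []. Qed.

Lemma inertia_mx_pos (v : 'cV[R]_(3 + 3)) : v != 0 -> 0 < dot v (inertia_mx B *m v).
Proof.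
move=> v0; rewrite -(vsubmxK v) /inertia_mx mul_block_col !mul0mx addr0 add0r.
rewrite dot_col_mx mul_scalar_mx -scalemxAl !dotZr.
have [u0|u0] := eqVneq (usubmx v) 0.
  have d0 : dsubmx v != 0.
    by apply: contra_neq v0 => d0; rewrite -(vsubmxK v) u0 d0 col_mx0.
  by rewrite u0 dot0l mulr0 add0r mulr_gt0// inertia_pos.
rewrite ltr_pwDl//; first by rewrite mulr_gt0// dot_gt0.
have [->|d0] := eqVneq (dsubmx v) 0; first by rewrite dot0l mulr0.
by rewrite mulr_ge0// ltW// inertia_pos.
Qed.

Lemma dyn_system_unique p : state_space B p ->
  exists! dl : 'cV[R]_(3 + 3) * 'cV[R]_l, dyn_system B p dl.
Proof.
move=> Mp; have := saddle_unique
  (ext_force B p - 8 *: Ktilde B p - bigH (jy p) *m grad (potential B) (jy p))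
  (jac (constraint B) (jy p) *m bigI (jy1 p) *m jy p -
     diff2 (constraint B) (jy p) (jy1 p)) inertia_mx_pos (indep Mp).
by rewrite trmx_mul trmxK.
Qed.

Lemma bigH_mul_tr (y : 'cV[R]_(3 + 4)) : dot (eul_of y) (eul_of y) = 1 ->
  bigH y *m (bigH y)^T = 1%:M.
Proof.
move=> y1; rewrite /bigH tr_block_mx trmx1 !trmx0 mulmx_block !mul0mx !mulmx0.
by rewrite mul1mx !addr0 add0r Hmx_mul_tr y1 -scalar_mx_block.
Qed.

Lemma bigI_mul (y y1 : 'cV[R]_(3 + 4)) :
  bigI y1 *m y = col_mx 0 (dot (eul_of y1) (eul_of y1) *: eul_of y).
Proof.
by rewrite -{1}(vsubmxK y) /bigI mul_block_col !mul0mx !add0r mul_scalar_mx.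
Qed.

Lemma bigH_bigI (y y1 : 'cV[R]_(3 + 4)) : bigH y *m (bigI y1 *m y) = 0.
Proof.
rewrite bigI_mul /bigH mul_block_col !mul0mx mulmx0 addr0 add0r -scalemxAr Hmx_self.
by rewrite scaler0 col_mx0.
Qed.

(** [bigH^T *m bigH] removes from [y2] its component along (0, theta), whose coefficient <theta,
    theta2> equals - |theta1|^2; subtracting [bigI y1 *m y] puts it back. *)
Lemma bigH_tr_bigH (y y1 y2 : 'cV[R]_(3 + 4)) : dot (eul_of y) (eul_of y) = 1 ->
  dot (eul_of y1) (eul_of y1) + dot (eul_of y) (eul_of y2) = 0 ->
  (bigH y)^T *m (bigH y *m y2) - bigI y1 *m y = y2.
Proof.
move=> yy /eqP; rewrite addr_eq0 => /eqP y12.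
rewrite bigI_mul y12 scaleNr -[X in bigH y *m X](vsubmxK y2) /bigH.
rewrite mul_block_col tr_block_mx trmx1 !trmx0 mul_block_col !mul1mx !mul0mx.
rewrite !addr0 !add0r mulmxA Hmx_tr_mul yy mulmxBl mul1mx -mulmxA.
rewrite opp_col_mx oppr0 opprK add_col_mx addr0.
rewrite (_ : _ *m ((eul_of y)^T *m _) = dot (eul_of y) (eul_of y2) *: eul_of y).
  by rewrite subrK vsubmxK.
by rewrite [X in _ *m X]mx11_scalar mul_mx_scalar.
Qed.

Lemma dot_eul_bigH_tr (y : 'cV[R]_(3 + 4)) d :
  dot (eul_of y) (eul_of ((bigH y)^T *m d)) = 0.
Proof.
rewrite -(vsubmxK d) /bigH tr_block_mx trmx1 !trmx0 mul_block_col !mul0mx add0r.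
by rewrite /eul_of col_mxKd dot_mulmxr trmxK Hmx_self dot0l.
Qed.

Lemma one_dimensional_dyn p : state_space B p ->
  one_dimensional (dyn_distribution B p).
Proof.
move=> Mp; have [dl [dlS dlU]] := dyn_system_unique Mp.
exists ((1, jy1 p, acceleration p dl.1) : jet R).
  by apply/eqP => -[/eqP]; rewrite oner_eq0.
apply/seteqP; split => v /=.
  by move=> [dl' /dlU <- [c ->]]; exists c.
by move=> [c _ <-]; exists dl => //; exists c.
Qed.

Lemma dyn_distribution_cartan p : dyn_distribution B p `<=` cartan p.
Proof.
move=> v [dl _ [c ->]] i; rewrite /jy /jt /= mxE.
by rewrite -[c *: 1]/(c * 1); ring.
Qed.

(** One map for both kinds of constraints, so that the results on level sets apply once: the state
    space consists of its zeros [y] with [y1] in the kernel of its differential. *)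
Let euler_constraint (y : 'cV[R]_(3 + 4)) : 'cV[R]_(1 + l) :=
  col_mx (const_mx (dot (eul_of y) (eul_of y) - 1)) (constraint B y).

Let euler_constraint_smooth : smooth_on setT euler_constraint.
Proof.
move=> k; have eulk : Ck_on k setT (@eul_of R).
  by apply: (Ck_on_mxlin dsubmx openT); exact: Ck_on_id.
apply: (Ck_on_col_mx openT); last exact: constraint_smooth.
apply: (Ck_on_mx openT) => i j; under eq_fun do rewrite mxE.
apply: (Ck_onD openT); last exact: Ck_on_cst.
apply: (Ck_on_coord 0 0 openT); apply: (Ck_on_mulmx openT) => //.
exact: (Ck_on_mxlin trmx openT).
Qed.

Let eul_diff (y : 'cV[R]_(3 + 4)) : is_diff y (@eul_of R) (@eul_of R).
Proof. exact: (is_diff_mxlin dsubmx (is_diff_id y)). Qed.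

Let euler_constraint_diff y v : 'd euler_constraint y v =
  col_mx (const_mx (2 * dot (eul_of y) (eul_of v)))
    (jac (constraint B) y *m v).
Proof.
have cd := differentiableP (smooth_on_differentiable (x := y) constraint_smooth Logic.I).
have nd : is_diff y (fun y => const_mx (dot (eul_of y) (eul_of y) - 1) : 'cV[R]_1)
    (fun v => const_mx (2 * dot (eul_of y) (eul_of v))).
  apply: is_diff_mx => i j.
  have D := is_diffB (is_diff_dot (eul_diff y) (eul_diff y)) (is_diff_cst (1 : R) y).
  apply: (is_diff_ext _ _ D) => w; first by rewrite mxE.
  rewrite fctE mxE -[LHS]/(_ + _ - 0) subr0 [X in _ + X]dotC; ring.
apply: (etrans (is_diff_val v (is_diff_col_mx nd cd))).
by congr col_mx; exact/esym/jac_mulmx.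
Qed.

Let euler_constraint_diff2 y v : diff2 euler_constraint y v =
  col_mx (const_mx (2 * dot (eul_of v) (eul_of v))) (diff2 (constraint B) y v).
Proof.
have cd := differentiableP (smooth_on_differentiable (x := y)
  (smooth_on_diff v constraint_smooth) Logic.I).
have nd : is_diff y (fun y => const_mx (2 * dot (eul_of y) (eul_of v)) : 'cV[R]_1)
    (fun w => const_mx (2 * dot (eul_of w) (eul_of v))).
  apply: is_diff_mx => i j.
  have D := is_diffZ 2 (is_diff_dot (eul_diff y) (is_diff_cst (eul_of v) y)).
  apply: (is_diff_ext _ _ D) => w; first by rewrite mxE.
  by rewrite fctE mxE -[LHS]/(2 * (_ + _)) [X in X + _]dotC dot0l add0r.
have D := is_diff_col_mx nd cd.
have E : (fun z => 'd euler_constraint z v) = fun z =>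
    col_mx (const_mx (2 * dot (eul_of z) (eul_of v))) ('d (constraint B) z v).
  apply/funext => z; apply: (etrans (euler_constraint_diff z v)).
  by congr col_mx; exact: jac_mulmx.
apply: (etrans (congr1 (fun f => 'd f y v) E)).
exact: (is_diff_val v D).
Qed.

(** The time [t] is independent of the parameter [s] because the constraints do not involve time;
    this allows time to run at any speed along the curve. *)
Lemma state_space_curve (p : jet R) (y2 : 'cV[R]_(3 + 4)) :
  state_space B p ->
  dot (eul_of (jy1 p)) (eul_of (jy1 p)) + dot (eul_of (jy p)) (eul_of y2) = 0 ->
  jac (constraint B) (jy p) *m y2 + diff2 (constraint B) (jy p) (jy1 p) = 0 ->
  exists (y : R -> 'cV[R]_(3 + 4)) (e : R), [/\ 0 < e, smooth_on `]-e, e[ y,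
    forall s t, s \in `]-e, e[ -> state_space B (t, y s, y^`()%classic s) &
    [/\ y 0 = jy p, y^`()%classic 0 = jy1 p & y^`()^`()%classic 0 = y2]].
Proof.
move=> Mp th2 g2; have [[th0 th1] [g0 g1]] := Mp.
have /eqP/row_freeP[S HS] := indep Mp.
pose D := jac (constraint B) (jy p); rewrite -/D in HS g1 g2.
pose T := (bigH (jy p))^T *m S.
have DT : D *m T = 1%:M by rewrite mulmxA.
(* The factor 1/2 normalises the differential of |theta|^2 to 1 on [w0]. Subtracting
   [T *m (D *m w0)] then kills the image under dg without affecting that value, since the range of
   [T] is orthogonal to theta. *)
pose w0 : 'cV[R]_(3 + 4) := col_mx 0 (2^-1 *: eul_of (jy p)).
pose W : 'M[R]_(3 + 4, 1 + l) := row_mx (w0 - T *m (D *m w0)) T.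
have JE v : jac euler_constraint (jy p) *m v =
    col_mx (const_mx (2 * dot (eul_of (jy p)) (eul_of v))) (D *m v).
  by apply: (etrans (jac_mulmx _ _ _)); exact: euler_constraint_diff.
have eulT u : dot (eul_of (jy p)) (eul_of (T *m u)) = 0.
  by rewrite /T -mulmxA dot_eul_bigH_tr.
clearbody T.
have JW : jac euler_constraint (jy p) *m W = 1%:M.
  apply: mulmx_fix_eq1 => v.
  rewrite -(vsubmxK v) -mulmxA JE /W mul_row_col; congr col_mx.
    apply/matrixP => i j; rewrite (ord1 i) (ord1 j) mxE.
    rewrite [usubmx v in LHS]mx11_scalar mul_mx_scalar /eul_of linearD linearZ linearB /=.
    rewrite -!/(eul_of _) dotDr dotZr dotDr -scaleN1r dotZr !eulT.
    by rewrite /eul_of col_mxKd dotZr th0; field.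
  rewrite mulmxDr !mulmxA DT mul1mx.
  by rewrite mulmxBr !mulmxA DT mul1mx subrr mul0mx add0r.
have [|||y [e [e0 ys yG y0]]] := @level_curve _ _ _ euler_constraint
  (jy p) (jy1 p) y2 W euler_constraint_smooth JW.
- by rewrite /euler_constraint th0 subrr g0 -col_mx0; congr col_mx;
     apply/matrixP => i j; rewrite !mxE.
- by rewrite JE th1 g1 mulr0 -col_mx0; congr col_mx; apply/matrixP => i j; rewrite !mxE.
- rewrite JE euler_constraint_diff2 add_col_mx g2 -col_mx0; congr col_mx.
  by apply/matrixP => i j; rewrite !mxE -mulrDr addrC th2 mulr0.
exists y, e; split => // s t se.
have Io : open [set` `]-e, e[] by exact: interval_open.
have := level_curve_derive1 Io ys euler_constraint_smooth yG se.
rewrite euler_constraint_diff -col_mx0 => /eq_col_mx[d1 d2].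
have := yG s se; rewrite /euler_constraint -col_mx0 => /eq_col_mx[c1 c2].
split; split => //=.
  by move/matrixP: c1 => /(_ 0 0)/eqP; rewrite !mxE subr_eq0 => /eqP.
move/matrixP: d1 => /(_ 0 0)/eqP; rewrite !mxE mulf_eq0 pnatr_eq0 /= => /eqP.
by [].
Qed.

Lemma dyn_distribution_tangent p : state_space B p ->
  dyn_distribution B p `<=` tangent_space (state_space B) p.
Proof.
move=> Mp v [dl [_ dl2] [c ->]]; have [[th0 _] _] := Mp.
set y2 := acceleration p dl.1.
have th2 : dot (eul_of (jy1 p)) (eul_of (jy1 p)) + dot (eul_of (jy p)) (eul_of y2) = 0.
  have -> : eul_of y2 = eul_of ((bigH (jy p))^T *m dl.1) -
    eul_of (bigI (jy1 p) *m jy p) by exact: linearB.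
  rewrite dotDr dotNr dot_eul_bigH_tr add0r bigI_mul.
  by rewrite [eul_of (col_mx _ _)]col_mxKd dotZr th0 mulr1 subrr.
have g2 : jac (constraint B) (jy p) *m y2 + diff2 (constraint B) (jy p) (jy1 p) = 0.
  by rewrite /y2 /acceleration mulmxBr !mulmxA dl2 addrAC subrK subrr.
have [y [e [e0 ys yM [y0 y01 y02]]]] := state_space_curve Mp th2 g2.
(* For |s| < [e'] the rescaled parameter [c * s] stays in the domain of [y]; the summand 1 covers
   [c = 0]. *)
pose e' := e / (`|c| + 1); have c1 : 0 < `|c| + 1 by rewrite ltr_wpDl.
have e'0 : 0 < e' by rewrite divr_gt0.
have sub s : s \in `]-e', e'[ -> c * s \in `]-e, e[.
  rewrite !in_itv /= -!ltr_norml /e' ltr_pdivlMr// normrM => se.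
  apply: le_lt_trans se; rewrite mulrC ler_wpM2l//.
  by rewrite lerDl.
have Io : open [set` `]-e, e[] by exact: interval_open.
have I'o : open [set` `]-e', e'[] by exact: interval_open.
have I0 : (0 : R) \in `]-e, e[ by rewrite in_itv /= oppr_lt0 e0.
(* The prolonged curve run at speed [c], whose velocity at 0 is [c] times (1, y1, y2). *)
exists e', (fun s => (jt p + c * s, y (c * s), y^`()%classic (c * s))).
have ys1 := smooth_derive1 Io ys.
have scd : is_diff (0 : R) (fun s : R => c * s) (fun s => c * s).
  exact: is_diff_scaler.
have I0c : (c * 0) \in `]-e, e[ by rewrite mulr0.
have D1 := is_diff_comp scd (smooth_curve_is_diff ys I0c).
have D2 := is_diff_comp scd (smooth_curve_is_diff ys1 I0c).
have D0 := is_diffD (is_diff_cst (jt p) (0 : R)) scd.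
split => //.
- move=> k; apply: (Ck_on_pair I'o); first apply: (Ck_on_pair I'o).
  + apply: (Ck_onD I'o); first exact: Ck_on_cst.
    apply: (Ck_onM I'o); first exact: Ck_on_cst.
    exact: Ck_on_id.
  + exact: (Ck_on_sub sub (Ck_on_scale c Io (ys k))).
  + exact: (Ck_on_sub sub (Ck_on_scale c Io (ys1 k))).
- by move=> s /sub; exact: yM.
- by rewrite mulr0 addr0 y0 y01; case: (p) => -[].
rewrite (is_diff_derive1 (is_diff_pair (is_diff_pair D0 D1) D2)) /=.
rewrite !fctE mulr0 mulr1 add0r y01 y02.
by rewrite -[RHS]/(c * 1, c *: jy1 p, c *: y2) mulr1.
Qed.

(** * Motions as integral curves *)

Let velocity_constraints (I : set R) (y : R -> 'cV[R]_(3 + 4)) t :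
  open I -> smooth_on I y ->
  (forall s, I s -> S3 (eul_of (y s)) /\ constraint B (y s) = 0) -> I t ->
  let y1 := y^`()%classic t in let y2 := y^`()^`()%classic t in
  [/\ state_space B (prolong y t),
    dot (eul_of y1) (eul_of y1) + dot (eul_of (y t)) (eul_of y2) = 0 &
    jac (constraint B) (y t) *m y2 + diff2 (constraint B) (y t) y1 = 0].
Proof.
move=> Io ys yM It y1 y2; have [th0 g0] := yM t It.
have Gy s : I s -> euler_constraint (y s) = 0.
  move=> /yM[th g]; apply: etrans (_ : col_mx 0 0 = _); last exact: col_mx0.
  congr col_mx; last exact: g.
  by apply/matrixP => i j; rewrite !mxE th subrr.
have := level_curve_derive1 Io ys euler_constraint_smooth Gy It.
rewrite euler_constraint_diff -col_mx0 => /eq_col_mx[d1 d2].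
have := level_curve_derive2 Io ys euler_constraint_smooth Gy It.
rewrite euler_constraint_diff euler_constraint_diff2 add_col_mx -col_mx0.
move=> /eq_col_mx[e1 e2]; split => //.
- split; split => //=.
  by move/matrixP: d1 => /(_ 0 0)/eqP; rewrite !mxE mulf_eq0 pnatr_eq0 /= => /eqP.
- have aux (a b : R) : const_mx (2 * a) + const_mx (2 * b) = 0 :> 'cV[R]_1 -> b + a = 0.
    by move=> /matrixP/(_ 0 0); rewrite !mxE; lra.
  exact: aux e1.
Qed.

Let prolong_derive1 (I : set R) (y : R -> 'cV[R]_(3 + 4)) t :
  open I -> smooth_on I y -> I t ->
  (prolong y)^`()%classic t = (1, y^`()%classic t, y^`()^`()%classic t).
Proof.
move=> Io ys It.
have D1 := smooth_curve_is_diff ys It.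
have D2 := smooth_curve_is_diff (smooth_derive1 Io ys) It.
have D := is_diff_pair (is_diff_pair (is_diff_id t) D1) D2.
by rewrite (is_diff_derive1 D) /= !scale1r.
Qed.

(** The first line of the system with [d = bigH *m y2]; along a constrained curve the second line is
    the twice differentiated constraint. *)
Let body_equation p (y2 : 'cV[R]_(3 + 4)) (la : 'cV[R]_l) :=
  inertia_mx B *m (bigH (jy p) *m y2) + bigH (jy p) *m (jac (constraint B) (jy p))^T *m la
  = ext_force B p - 8 *: Ktilde B p - bigH (jy p) *m grad (potential B) (jy p).

Lemma dyn_distribution_body_equation (I : set R) (y : R -> 'cV[R]_(3 + 4)) t :
  open I -> smooth_on I y ->
  (forall s, I s -> S3 (eul_of (y s)) /\ constraint B (y s) = 0) -> I t ->
  dyn_distribution B (prolong y t) ((prolong y)^`()%classic t) <->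
  exists la, body_equation (prolong y t) (y^`()^`()%classic t) la.
Proof.
move=> Io ys yM It; have [Mp th2 g2] := velocity_constraints Io ys yM It.
have [th0 _] := yM t It.
rewrite (prolong_derive1 Io ys It); set y2 := y^`()^`()%classic t in th2 g2 *.
have HH := bigH_tr_bigH th0 th2.
split=> [[[d la] [/= dl1 dl2] [c]]|[la E]].
  (* The time component of a prolonged curve has derivative 1, which forces [c = 1]. *)
  move=> [/esym/eqP]; rewrite -[c *: 1]/(c * 1) mulr1 => /eqP -> _.
  rewrite scale1r => y2E; exists la; rewrite /body_equation -dl1; congr (_ *m _ + _).
  by rewrite y2E mulmxBr bigH_bigI subr0 mulmxA bigH_mul_tr// mul1mx.
exists (bigH (y t) *m y2, la) => /=.
  split => //=; rewrite -mulmxA.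
  have -> : (bigH (y t))^T *m (bigH (y t) *m y2) = y2 + bigI (y^`()%classic t) *m y t.
    by rewrite -{2}HH subrK.
  rewrite mulmxDr mulmxA addrC; congr (_ + _).
  by apply/eqP; rewrite -addr_eq0 g2.
by exists 1; rewrite scale1r /acceleration HH.
Qed.

Lemma euler_lagrange_body_equation (I J : set R) (y : R -> 'cV[R]_(3 + 4))
    (A : set 'cV[R]_3) (phi : 'cV[R]_3 -> 'cV[R]_4) (alpha : R -> 'cV[R]_3) t la :
  open I -> open J -> J `<=` I -> smooth_on I y -> local_param A phi ->
  (forall s, J s -> A (alpha s) /\ eul_of (y s) = phi (alpha s)) -> J t ->
  S3 (eul_of (y t)) ->
  let q s := col_mx (pos_of (y s)) (alpha s) in
  euler_lagrange B phi q t =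
      col_mx (force B (prolong y t))
        (2 *: ((jac phi (alpha t))^T *m (Hmx (eul_of (y t)))^T
               *m torque B (prolong y t)))
      - (jac (constraint B \o chart_map phi) (q t))^T *m la <->
  body_equation (prolong y t) (y^`()^`()%classic t) la.
Proof.
move=> Io Jo JI ys chart al Jt th0 q.
have [S Su [-> -> ->]] := euler_lagrange_chart inertia_sym potential_smooth
  constraint_smooth Io Jo JI ys chart al Jt th0.
rewrite -mulmxA -mulmxBr /body_equation.
have aux n (a k g f x : 'cV[R]_n) : a + k + g = f - x <-> a + x = f - k - g.
  by split=> /matrixP E; apply/matrixP => i j; have := E i j; rewrite !mxE; lra.
split=> [/(can_inj (mulKmx Su))/aux//|/aux E].
exact: (congr1 (mulmx S) E).
Qed.

Lemma is_motion_iff (I : set R) (y : R -> 'cV[R]_(3 + 4)) :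
  open I -> smooth_on I y ->
  is_motion B I y <->
  (forall t, I t -> state_space B (prolong y t)) /\
  integral_curve I (prolong y) (dyn_distribution B).
Proof.
move=> Io ys; split=> [[yM EL]|[yM yD]].
  split=> t It; first by have [] := velocity_constraints Io ys yM It.
  apply/(dyn_distribution_body_equation Io ys yM It).
  have [th0 g0] := yM t It; pose x0 := eul_of (y t).
  (* The chart is centred at theta(t) and used while theta(s) avoids the antipode; [t] qualifies
     because [1 + dot x0 x0 = 2]. *)
  pose J := [set s | I s /\ 1 + dot x0 (eul_of (y s)) != 0].
  pose alpha s := stereo_inv x0 (eul_of (y s)).
  have JI : J `<=` I by move=> s [].
  have al s : J s -> setT (alpha s) /\ eul_of (y s) = stereo x0 (alpha s).
    by move=> [Is ns]; split => //; rewrite stereo_invK//; have [] := yM s Is.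
  have Jo : open J.
    rewrite openE => s [Is ns].
    have yd := smooth_curve_is_diff ys Is.
    have fd := is_diffD (is_diff_cst (1 : R) s)
      (is_diff_dot (is_diff_cst x0 s) (is_diff_mxlin dsubmx yd)).
    have fc := differentiable_continuous (@ex_diff _ _ _ _ _ _ _ fd).
    have NI : \forall r \near s, I r by exact: open_nbhs_nbhs.
    have N0 : \forall r \near s, 1 + dot x0 (eul_of (y r)) != 0.
      apply: (@near_fun _ _ _ s [set x | x != 0] fc).
      by apply: open_nbhs_nbhs; split => //; exact: open_neq.
    by near=> r; split; near: r.
  have Jt : J t.
    by split => //; rewrite -/x0 th0 -[1 + 1]/(2%:R) pnatr_eq0.
  have chart : local_param setT (stereo x0) by exact: stereo_local_param.
  have [la E] := EL _ _ chart J alpha Jo JI al t Jt.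
  exists la.
  exact: (euler_lagrange_body_equation la Io Jo JI ys chart al Jt th0).1.
have yS t : I t -> S3 (eul_of (y t)) /\ constraint B (y t) = 0.
  by move=> /yM[[th0 _] [g0 _]].
(* Here the chart is arbitrary, and the multiplier of the linear system serves for all of them. *)
split=> // A phi chart J alpha Jo JI al q t Jt.
have [th0 _] := yS t (JI t Jt).
have [la E] := (dyn_distribution_body_equation Io ys yS (JI t Jt)).1 (yD t (JI t Jt)).
exists la.
exact: (euler_lagrange_body_equation la Io Jo JI ys chart al Jt th0).2.
Unshelve. all: by end_near. Qed.

End StateSpace.

Unset Implicit Arguments.
Set Strict Implicit.

Theorem theorem3p1 (R : realType) (l : nat) (B : rigid_body R l)
    (data_ok : well_posed_data B) (indep : independent_constraints B) :
  [/\ forall p : jet R, state_space B p ->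
        exists! dl : 'cV[R]_(3 + 3) * 'cV[R]_l, dyn_system B p dl,
      forall p : jet R, state_space B p ->
        one_dimensional (dyn_distribution B p) /\
        dyn_distribution B p `<=` tangent_space (state_space B) p `&` cartan p
    & forall (I : set R) (y : R -> 'cV[R]_(3 + 4)),
        open I -> is_interval I -> smooth_on I y ->
        (is_motion B I y <->
         (forall t, I t -> state_space B (prolong y t)) /\
         integral_curve I (prolong y) (dyn_distribution B))].
Proof.
split=> [p Mp|p Mp|I y Io _ ys].
- exact: dyn_system_unique.
- split; first exact: one_dimensional_dyn.
  move=> v Dv; split; last exact: dyn_distribution_cartan Dv.
  exact: dyn_distribution_tangent Dv.
- exact: is_motion_iff.
Qed.
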